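(* Let $\Omega$ be a Polish space with Borel $\sigma$-field $\mathcal F$. Let $D\subset C_b(\Omega)$ be an $\mathbb R$-vector space with $1\in D$ that separates $\mathrm{ca}^+_{\le1}(\Omega)$, i.e. for any $\mathbb Q,\mathbb Q'\in\mathrm{ca}^+_{\le1}(\Omega)$, $\mathbb Q=\mathbb Q'$ if and only if $\mathbb E^{\mathbb Q}[\varphi]=\mathbb E^{\mathbb Q'}[\varphi]$ for all $\varphi\in D$. For any positive-constant-preserving (PCP) convex expectations $\mathcal E$ and $\widehat{\mathcal E}$ on $\Omega$, the following are equivalent: (a) $\mathcal E\le\widehat{\mathcal E}$ on $\mathrm{USA}_b(\Omega)$. (b) $\mathcal E\le\widehat{\mathcal E}$ on $D$.
   Context: $\mathrm{USA}_b(\Omega)$ is the space of bounded upper semianalytic functions $\varphi\colon\Omega\to\mathbb R$ (i.e. $\{\varphi\ge t\}$ is an analytic set for every $t\in\mathbb R$). $C_b(\Omega)$ is the space of bounded continuous real functions. $\mathrm{ca}^+_{\le1}(\Omega)$ is the set of finite measures $\mathbb Q$ on $(\Omega,\mathcal F)$ with $\mathbb Q(\Omega)\le1$, and $\mathbb E^{\mathbb Q}[\varphi]:=\int\varphi\,d\mathbb Q$. A map $\mathcal E\colon\mathrm{USA}_b(\Omega)\to\mathbb R$ is a positive-constant-preserving (PCP) convex expectation if: (E1) $\mathcal E(c)=c$ for all $c\in\mathbb R_+=[0,\infty)$; (E2) $\mathcal E(\varphi)\le\mathcal E(\psi)$ for all $\varphi,\psi\in\mathrm{USA}_b(\Omega)$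 with $\varphi\le\psi$; (E3) $\mathcal E(\lambda\varphi+(1-\lambda)\psi)\le\lambda\mathcal E(\varphi)+(1-\lambda)\mathcal E(\psi)$ for all $\lambda\in[0,1]$, $\varphi,\psi\in\mathrm{USA}_b(\Omega)$; (E4) for every $\varphi\in\mathrm{USA}_b(\Omega)$ and any sequence $(\varphi_n)\subset\mathrm{USA}_b(\Omega)$ with $\varphi_n\uparrow\varphi$ pointwise, $\mathcal E(\varphi_n)\uparrow\mathcal E(\varphi)$; (E5) for every $\varphi\in\mathrm{USA}_b(\Omega)$ and any sequence $(\varphi_n)\subset C_b(\Omega)$ with $\varphi_n\downarrow\varphi$ pointwise, $\mathcal E(\varphi_n)\downarrow\mathcal E(\varphi)$. *)

(* Defs.v *)
From mathcomp Require Import all_boot all_order all_algebra.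
From mathcomp Require Import all_classical all_reals all_analysis.

Set Implicit Arguments.
Unset Strict Implicit.
Unset Printing Implicit Defensive.

Import Order.TTheory GRing.Theory Num.Theory.
Import numFieldNormedType.Exports.

Local Open Scope classical_set_scope.
Local Open Scope ring_scope.

(* A property of the topology alone. Completeness is spelled out with
   [exists x], since the library's [completeType] is pointed and would exclude
   the empty space. *)
Definition polish (R : realType) (T : topologicalType) : Prop :=
  (exists2 S : set T, countable S & dense S) /\
  exists (M : metricType R) (f : T -> M) (g : M -> T),
    [/\ cancel f g, cancel g f, continuous f, continuous g
      & forall F : set_system M, ProperFilter F -> cauchy F ->
          exists x : M, F --> x].

(* The space Y may be empty, so that the empty set is analytic. *)
Definition analytic (R : realType) (T : topologicalType) (A : set T) : Prop :=
  exists (Y : topologicalType) (f : Y -> T),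
    [/\ polish R Y, continuous f & range f = A].

Definition USAb (R : realType) (T : topologicalType) : set (T -> R) :=
  [set phi | bounded_fun phi /\
             forall t : R, analytic R [set x | t <= phi x]].

Definition Cb (R : realType) (T : topologicalType) : set (T -> R) :=
  [set phi | bounded_fun phi /\ continuous phi].

Notation borelType T := (g_sigma_algebraType (@open T)).

(* Measures are compared on Borel sets only: the values of the underlying
   function on other sets are unconstrained. *)
Definition separates_subprobabilities (R : realType) (T : ptopologicalType)
    (D : set (T -> R)) : Prop :=
  forall Q Q' : subprobability (borelType T) R,
    (forall A : set (borelType T), measurable A -> Q A = Q' A) <->
    (forall phi, D phi ->
       (\int[Q]_x (phi x)%:E = \int[Q']_x (phi x)%:E)%E).

Definition seq_incr_to (R : realType) (u : nat -> R) (l : R) : Prop :=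
  nondecreasing_seq u /\ u @ \oo --> l.

Definition seq_decr_to (R : realType) (u : nat -> R) (l : R) : Prop :=
  nonincreasing_seq u /\ u @ \oo --> l.

(* An expectation is a map on [USAb]; it is encoded as a total functional whose
   values outside [USAb] are irrelevant. *)
Record PCP_convex_expectation (R : realType) (T : topologicalType)
    (E : (T -> R) -> R) : Prop := {
  pcp_cst : forall c : R, 0 <= c -> E (cst c) = c ;
  pcp_le : forall phi psi, USAb phi -> USAb psi ->
    (forall x, phi x <= psi x) -> E phi <= E psi ;
  pcp_convex : forall (lambda : R) phi psi, 0 <= lambda <= 1 ->
    USAb phi -> USAb psi ->
    E (fun x => lambda * phi x + (1 - lambda) * psi x)
      <= lambda * E phi + (1 - lambda) * E psi ;
  pcp_incr : forall (phi : T -> R) (phi_ : nat -> T -> R),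
    USAb phi -> (forall n, USAb (phi_ n)) ->
    (forall x, seq_incr_to (fun n => phi_ n x) (phi x)) ->
    seq_incr_to (fun n => E (phi_ n)) (E phi) ;
  pcp_decr : forall (phi : T -> R) (phi_ : nat -> T -> R),
    USAb phi -> (forall n, Cb (phi_ n)) ->
    (forall x, seq_decr_to (fun n => phi_ n x) (phi x)) ->
    seq_decr_to (fun n => E (phi_ n)) (E phi)
}.

(* Main.v *)
(* For (b) => (a), the inequality is first extended from D to C_b. Let l be a
   linear form on C_b that is a subgradient of E at phi0 (Hahn-Banach), and set
   alpha = l phi0 - E phi0. Then l <= E + alpha on C_b, hence l <= E' + alpha on D,
   and by Hahn-Banach again l restricted to D extends to a linear form l' on C_b
   with l' <= E' + alpha. Both domination bounds make l and l' positive, of mass at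
   most 1, and continuous from above at 0, so by Daniell-Stone they are integrals
   against subprobabilities. These agree on D, hence are equal, so that
   E phi0 = l phi0 - alpha = l' phi0 - alpha <= E' phi0.
   The inequality then passes from C_b to USA_b by Choquet capacitability: for
   r < E phi there is psi <= phi, a decreasing limit of functions in C_b, with
   r <= E psi <= E' psi <= E' phi. *)

Require Import Defs.
From HB Require Import structures.
From mathcomp Require Import all_boot all_order all_algebra.
From mathcomp Require Import all_classical all_reals all_analysis.
From mathcomp Require Import measurable_realfun ring lra.

Set Implicit Arguments.
Unset Strict Implicit.
Unset Printing Implicit Defensive.

Import Order.TTheory GRing.Theory Num.Theory.
Import numFieldNormedType.Exports.

Local Open Scope classical_set_scope.
Local Open Scope ring_scope.

(** The expectations are convex but not positively homogeneous, so domination carries the additive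
    constant [alpha]. It is harmless because the forms are homogeneous: tested on [c *: u] with [c]
    large in absolute value, the constant becomes negligible. Constants are preserved only when
    nonnegative, which bounds the mass from above but not from below; this is why the forms are
    integrals against subprobabilities and [D] has to separate those.

    A Polish space need not be locally compact, so the representing measures cannot rest on
    compactly supported functions; continuity from above at 0 takes over the role of compactness.

    In the capacitability step, continuity from below holds only within USA_b, and continuity from
    above only along sequences in C_b. The function is therefore first replaced by one with finitely
    many values, parametrized by a complete separable metric space. Suprema over closed sets of
    parameters are then attained, so that they stay in USA_b, and Lipschitz envelopes provide the
    approximation from above. *)

(** * Hahn-Banach extension dominated by a convex function *)

Section HahnBanach.
Context {R : realType} {V : lmodType R} (C : set V) (p : V -> R).
Hypothesis C_submod : submod_closed [in C].
Hypothesis p_convex : forall t u v, 0 <= t <= 1 -> C u -> C v ->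
  p (t *: u + (1 - t) *: v) <= t * p u + (1 - t) * p v.

(* Partial linear forms are encoded by their graphs. The domination by [p]
   forces such a graph to be single-valued, see [dominated_graph_fun]. *)
Let dominated_graph (G : set (V * R)) :=
  [/\ G (0, 0),
      forall c z w, G z -> G w -> G (c *: z.1 + w.1, c * z.2 + w.2)
    & forall z, G z -> C z.1 /\ z.2 <= p z.1].

Let C_lin c u v : C u -> C v -> C (c *: u + v).
Proof.
by move=> Cu Cv; have := C_submod.2 c u v; rewrite !inE; exact.
Qed.

Let dominated_graph_fun G u a b :
  dominated_graph G -> G (u, a) -> G (u, b) -> a = b.
Proof.
move=> [G0 Glin Gp] Ga Gb; apply/eqP; rewrite -subr_eq0; apply/negPn/negP => ab.
(* Otherwise the graph contains the whole vertical line over 0, in particular the point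
   [(0, p 0 + 1)], which domination by [p] excludes. *)
have /Gp[_ /=] := Glin ((p 0 + 1) / (a - b)) _ _ (Glin (-1) _ _ Gb Ga) G0.
rewrite !scaleN1r addNr scaler0 addr0 mulN1r addr0 addrC.
rewrite (addrC (- b)) divfK //; lra.
Qed.

(** The inequalities with [t < 0] bound [r] from below, those with [t > 0] from above, and [r] is
    the supremum of the lower bounds, collected in [S]. A lower and an upper bound are compatible by
    convexity of [p], applied to the combination of [w.1 - s *: x] and [z.1 + t *: x] in which [x]
    cancels. *)
Let extension_value G x : dominated_graph G -> C x ->
  exists r : R, forall t z, G z -> z.2 + t * r <= p (z.1 + t *: x).
Proof.
move=> [G0 Glin Gp] Cx.
pose S : set R := [set y | exists2 s : R, 0 < s &
  exists2 z, G z & y = (z.2 - p (z.1 - s *: x)) / s].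
have C0 : C 0 by have /Gp[] := G0.
have CZ c : C (c *: x) by rewrite -[_ *: _]addr0; exact: C_lin.
have S_ub t z : 0 < t -> G z -> ubound S ((p (z.1 + t *: x) - z.2) / t).
  move=> t0 Gz _ [s s0 [w Gw ->]].
  have st0 : 0 < s + t by lra.
  pose l := t / (s + t).
  have l01 : 0 <= l <= 1.
    by rewrite divr_ge0 ?(ltW t0) ?(ltW st0)//= ler_pdivrMr//; lra.
  have lE : 1 - l = s / (s + t) by rewrite /l; field; rewrite gt_eqF.
  have comb : l *: (w.1 - s *: x) + (1 - l) *: (z.1 + t *: x) =
              l *: w.1 + (1 - l) *: z.1.
    rewrite scalerBr scalerDr !scalerA lE /l.
    rewrite (_ : t / (s + t) * s = s / (s + t) * t); last by ring.
    rewrite addrACA [- _ + _]addrC subrr addr0 //.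
  have Cw : C (w.1 - s *: x).
    by rewrite addrC -scaleNr; apply: C_lin => //; have /Gp[] := Gw.
  have Cz : C (z.1 + t *: x).
    by rewrite addrC; apply: C_lin => //; have /Gp[] := Gz.
  have := p_convex l01 Cw Cz; rewrite comb.
  have /Gp[_ /=] := Glin l w _ Gw (Glin (1 - l) _ _ Gz G0).
  rewrite !addr0 => h1 h2; have {h1 h2} := le_trans h1 h2.
  rewrite lE /l => h.
  rewrite ler_pdivrMr// mulrAC ler_pdivlMr//.
  have k0 : 0 < (s + t)^-1 by rewrite invr_gt0.
  rewrite -subr_ge0 -(pmulr_rge0 _ k0); rewrite -subr_ge0 in h.
  by apply: le_trans h _; rewrite le_eqVlt; apply/orP; left; apply/eqP; ring.
have S0 : S !=set0 by eexists; exists 1 => //; exists (0, 0).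
have supS : has_ubound S by exists ((p ((0, 0 : R).1 + 1 *: x) - 0) / 1); exact: S_ub.
exists (sup S) => t z Gz; have [t0|t0|->] := ltgtP t 0.
- have : (z.2 - p (z.1 + t *: x)) / - t <= sup S.
    apply: ub_le_sup => //; exists (- t); first by lra.
    by exists z => //; rewrite scaleNr opprK.
  by rewrite ler_pdivrMr ?oppr_gt0//; lra.
- have := ge_sup S0 (S_ub _ _ t0 Gz).
  by rewrite ler_pdivlMr//; lra.
- by rewrite scale0r mul0r !addr0; have /Gp[] := Gz.
Qed.

Let graph_extension G x : dominated_graph G -> C x ->
  exists2 G', dominated_graph G' & G `<=` G' /\ exists a, G' (x, a).
Proof.
move=> GG Cx; have [r rP] := extension_value GG Cx; have [G0 Glin Gp] := GG.
pose G' : set (V * R) := [set y | exists t, exists2 z, G z &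
  y = (z.1 + t *: x, z.2 + t * r)].
exists G'; last split.
- split.
  + by exists 0, (0, 0) => //=; rewrite scale0r mul0r !addr0.
  + move=> c _ _ [t [z Gz ->]] [s [w Gw ->]].
    exists (c * t + s), (c *: z.1 + w.1, c * z.2 + w.2); first exact: Glin.
    by rewrite /= scalerDr scalerA scalerDl addrACA; congr pair; ring.
  + move=> _ [t [z Gz ->]]; split; last exact: rP.
    by rewrite addrC; apply: C_lin => //; have /Gp[] := Gz.
- by move=> z Gz; exists 0, z => //; rewrite scale0r mul0r !addr0; case: (z).
- by exists r, 1, (0, 0) => //=; rewrite scale1r mul1r !add0r.
Qed.

Theorem hahn_banach_convex (M : set V) (l : V -> R) :
  submod_closed [in M] -> M `<=` C ->
  (forall c u v, M u -> M v -> l (c *: u + v) = c * l u + l v) ->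
  (forall u, M u -> l u <= p u) ->
  exists l' : V -> R,
    [/\ forall c u v, C u -> C v -> l' (c *: u + v) = c * l' u + l' v,
        forall u, M u -> l' u = l u
      & forall u, C u -> l' u <= p u].
Proof.
move=> M_submod MC l_lin lp.
pose G0 : set (V * R) := [set z | M z.1 /\ z.2 = l z.1].
have M0 : M 0 by have := M_submod.1; rewrite inE.
have G0_graph : dominated_graph G0.
  split.
  - split => //=.
    have := l_lin 1 0 0 M0 M0; rewrite scaler0 addr0 mul1r; lra.
  - move=> c z w [Mz ->] [Mw ->]; split => /=; last by rewrite l_lin.
    by have := M_submod.2 c z.1 w.1; rewrite !inE; exact.
  - by move=> z [Mz ->]; split; [exact: MC|exact: lp].
(* Adding [G0] inside the predicate makes it hold for the union of the empty chain, and makes the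
   maximal graph extend that of [l]. *)
have [|A [AP Amax]] := @Zorn_bigcup _ [set G | dominated_graph (G `|` G0)].
  move=> F FP Ftot.
  have [->|/set0P[X0 FX0]] := eqVneq F set0; first by rewrite /= bigcup_set0 set0U.
  have big z : (\bigcup_(X in F) X `|` G0) z -> exists2 X, F X & (X `|` G0) z.
    by move=> [[X FX Xz]|Gz]; [exists X => //; left|exists X0 => //; right].
  have sub X : F X -> X `|` G0 `<=` \bigcup_(X in F) X `|` G0.
    by move=> FX z [Xz|]; [left; exists X|right].
  split => /=.
  - by right; have [] := G0_graph.
  - move=> c z w /big[X FX Xz] /big[Y FY Yw].
    have [XY|YX] := Ftot _ _ FX FY.
    + have [_ Ylin _] := FP _ FY; apply: (sub Y) => //; apply: Ylin => //.
      by case: Xz => [/XY|]; [left|right].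
    + have [_ Xlin _] := FP _ FX; apply: (sub X) => //; apply: Xlin => //.
      by case: Yw => [/YX|]; [left|right].
  - by move=> z /big[X FX Xz]; have [_ _] := FP _ FX; exact.
pose G := A `|` G0.
have Gdom u : C u -> exists a, G (u, a).
  move=> Cu; have [G' GG' [GG'_sub [a G'a]]] := graph_extension AP Cu.
  exists a; apply: contrapT => nGa; apply: (Amax G').
    split; first by move=> z Az; apply: GG'_sub; left.
    by move=> /(_ _ G'a) Aa; apply: nGa; left.
  rewrite /= setUidl// => z G0z; apply: GG'_sub; right => //.
pose l' u := xget 0 [set a | G (u, a)].
have l'P u : C u -> G (u, l' u).
  by move=> /Gdom[a Ga]; rewrite /l'; case: xgetP => [b _ //|/(_ a)].
have [GG0 Glin Gp] := AP.
exists l'; split.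
- move=> c u v Cu Cv; apply: (dominated_graph_fun AP).
    by apply: l'P; exact: C_lin.
  by apply: (Glin c (u, l' u) (v, l' v)); exact: l'P.
- move=> u Mu; apply: (dominated_graph_fun AP); first exact/l'P/MC.
  by right.
- by move=> u /l'P/Gp[].
Qed.

End HahnBanach.

(** * Bounded continuous functions *)

Section BoundedContinuous.
Context {R : realType} {T : topologicalType}.
Implicit Types phi psi : T -> R.

Lemma bounded_funE phi : bounded_fun phi <-> exists M, forall x, `|phi x| <= M.
Proof.
split.
  move=> /ex_strict_bound_gt0[M _ Mphi]; exists M => x.
  by apply/ltW; exact: Mphi.
move=> [M Mphi]; exists M; split; first exact: num_real.
by move=> N MN x _; apply: le_trans (Mphi x) (ltW MN).
Qed.

Lemma CbP phi : Cb phi <-> (exists M, forall x, `|phi x| <= M) /\ continuous phi.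
Proof. by split => -[/bounded_funE ? ?]; split => //; apply/bounded_funE. Qed.

Lemma Cb_cst (c : R) : Cb (cst c : T -> R).
Proof. by apply/CbP; split; [exists `|c| |move=> x; exact: cvg_cst]. Qed.

Lemma Cb0 : Cb (0 : T -> R).
Proof. exact: (Cb_cst 0). Qed.

Lemma Cb_lin (c : R) phi psi : Cb phi -> Cb psi -> Cb (c *: phi + psi).
Proof.
move=> /CbP[[M Mphi] cphi] /CbP[[N Npsi] cpsi]; apply/CbP; split.
  exists (`|c| * M + N) => x; rewrite (le_trans (ler_normD _ _))// lerD//.
  by rewrite normrM ler_wpM2l.
by move=> x; apply: cvgD; [apply: cvgZr; exact: cphi|exact: cpsi].
Qed.

Lemma Cb_submod_closed : submod_closed [in @Cb R T].
Proof.
split; first by rewrite inE; exact: Cb0.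
by move=> c u v; rewrite !inE; exact: Cb_lin.
Qed.

Lemma Cb_add phi psi : Cb phi -> Cb psi -> Cb (phi + psi).
Proof. by move=> ? ?; rewrite -[phi]scale1r; exact: Cb_lin. Qed.

Lemma Cb_scale c phi : Cb phi -> Cb (c *: phi).
Proof. by move=> ?; rewrite -[_ *: _]addr0; apply: Cb_lin => //; exact: Cb0. Qed.

Lemma Cb_opp phi : Cb phi -> Cb (- phi).
Proof. by move=> ?; rewrite -scaleN1r; exact: Cb_scale. Qed.

Lemma Cb_sub phi psi : Cb phi -> Cb psi -> Cb (phi - psi).
Proof. by move=> ? ?; apply: Cb_add => //; exact: Cb_opp. Qed.

Lemma Cb_sum (F : nat -> T -> R) n :
  (forall i, Cb (F i)) -> Cb (\sum_(i < n) F i).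
Proof.
move=> CF; elim/big_ind : _ => //; first exact: Cb0.
exact: Cb_add.
Qed.

Lemma continuous_bounded_Cb (M : R) phi :
  (forall x, 0 <= phi x <= M) -> continuous phi -> Cb phi.
Proof.
move=> phiM cphi; apply/CbP; split => //; exists M => x.
by have /andP[p0 pM] := phiM x; rewrite ger0_norm.
Qed.

Lemma continuous_min_fun phi psi : continuous phi -> continuous psi ->
  continuous (fun x => Num.min (phi x) (psi x)).
Proof. exact: min_fun_continuous. Qed.

Lemma Cb_min phi psi : Cb phi -> Cb psi -> Cb (phi \min psi).
Proof.
move=> /CbP[[M Mphi] cphi] /CbP[[N Npsi] cpsi]; apply/CbP; split.
  exists (Num.max M N) => x /=; rewrite le_max.
  by have [_|_] := leP (phi x) (psi x); rewrite ?Mphi ?Npsi ?orbT.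
exact: continuous_min_fun.
Qed.

Lemma Cb_max phi psi : Cb phi -> Cb psi -> Cb (phi \max psi).
Proof.
move=> Cphi Cpsi; rewrite (_ : _ \max _ = - (- phi \min - psi)).
  by apply/Cb_opp/Cb_min; exact: Cb_opp.
apply/funext => x; rewrite [RHS](_ : _ = - Num.min (- phi x) (- psi x)) //.
by rewrite oppr_min !opprK.
Qed.

End BoundedContinuous.

(** * Daniell-Stone representation on C_b *)

Section SubprobabilityOf.
Context d (T : measurableType d) (R : realType).
Variables (Q0 : {measure set T -> \bar R}) (Q0_le1 : (Q0 setT <= 1)%E).

Definition subprobability_of of (Q0 setT <= 1)%E : set T -> \bar R := Q0.

HB.instance Definition _ := Measure.copy (subprobability_of Q0_le1) Q0.

HB.instance Definition _ := Measure_isSubProbability.Build d T R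
  (subprobability_of Q0_le1) Q0_le1.

End SubprobabilityOf.

Section DaniellStone.
Context {R : realType} {T : ptopologicalType}.
(** Substitute for metrizability: the indicator of an open set becomes an increasing limit of
    functions [min (k * h) 1] in C_b. *)
Hypothesis cozero : forall U : set T, open U -> exists h : T -> R,
  [/\ continuous h, forall x, 0 <= h x & U = [set x | 0 < h x]].
Variable l : (T -> R) -> R.
Hypothesis l_lin : forall c u v,
  Cb u -> Cb v -> l (c *: u + v) = c * l u + l v.
Hypothesis l_ge0 : forall u, Cb u -> (forall x, 0 <= u x) -> 0 <= l u.
Hypothesis l_le1 : l (cst 1) <= 1.
Hypothesis l_decr : forall u_ : nat -> T -> R, (forall n, Cb (u_ n)) ->
  (forall x, seq_decr_to (u_ ^~ x) 0) -> (fun n => l (u_ n)) @ \oo --> 0.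

Implicit Types (u v : T -> R) (A U V : set T).

Let l0 : l 0 = 0.
Proof.
have := l_lin 1 Cb0 Cb0; rewrite scaler0 addr0 mul1r; lra.
Qed.

Let lD u v : Cb u -> Cb v -> l (u + v) = l u + l v.
Proof. by move=> Cu Cv; rewrite -[u]scale1r l_lin// scale1r mul1r. Qed.

Let lZ c u : Cb u -> l (c *: u) = c * l u.
Proof.
by move=> Cu; rewrite -[_ *: _]addr0 l_lin ?l0 ?addr0//; exact: Cb0.
Qed.

Let lB u v : Cb u -> Cb v -> l (u - v) = l u - l v.
Proof.
by move=> Cu Cv; rewrite -scaleN1r addrC l_lin// mulN1r addrC.
Qed.

Let l_le u v : Cb u -> Cb v -> (forall x, u x <= v x) -> l u <= l v.
Proof.
move=> Cu Cv uv; rewrite -subr_ge0 -lB//; apply: l_ge0; first exact: Cb_sub.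
by move=> x; rewrite /= subr_ge0.
Qed.

Let l_sum (F : nat -> T -> R) n :
  (forall i, Cb (F i)) -> l (\sum_(i < n) F i) = \sum_(i < n) l (F i).
Proof.
move=> CF; elim: n => [|n ih]; first by rewrite !big_ord0.
by rewrite !big_ord_recr /= lD ?ih//; exact: Cb_sum.
Qed.

Definition subordinate U : set (T -> R) :=
  [set u | [/\ Cb u, forall x, 0 <= u x <= 1 & forall x, ~ U x -> u x = 0]].

(** As in the Riesz representation theorem, this is the prospective measure of an open set. The
    measure itself is the induced outer measure, restricted to Borel sets by Caratheodory's
    criterion. *)
Definition open_content U : \bar R :=
  ereal_sup [set (l u)%:E | u in subordinate U].

Definition daniell_outer A : \bar R :=
  ereal_inf [set open_content U | U in [set U | open U /\ A `<=` U]].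

Let subordinate0 U : subordinate U 0.
Proof.
by split => //; [exact: Cb0|move=> x; rewrite lexx ler01].
Qed.

Let open_content_ub U u : subordinate U u -> ((l u)%:E <= open_content U)%E.
Proof. by move=> Uu; apply: ereal_sup_ubound; exists u. Qed.

Let open_content_ge0 U : (0 <= open_content U)%E.
Proof. by have := open_content_ub (subordinate0 U); rewrite l0. Qed.

Let open_content_le1 U : (open_content U <= 1)%E.
Proof.
apply: ge_ereal_sup => _ [u [Cu u01 _] <-]; rewrite lee_fin.
apply: le_trans l_le1; apply: l_le => //; first exact: Cb_cst.
by move=> x; have /andP[] := u01 x.
Qed.

Let le_open_content U V : U `<=` V -> (open_content U <= open_content V)%E.
Proof.
move=> UV; apply: ge_ereal_sup => _ [u [Cu u01 uU] <-].
by apply: open_content_ub; split => // x Vx; apply: uU => /UV.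
Qed.

Let daniell_outer_open U : open U -> daniell_outer U = open_content U.
Proof.
move=> oU; apply/eqP; rewrite eq_le; apply/andP; split.
  by apply: ereal_inf_lbound; exists U => //; split.
by apply: le_ereal_inf_tmp => _ [V [_ UV] <-]; exact: le_open_content.
Qed.

Let le_daniell_outer A U : open U -> A `<=` U ->
  (daniell_outer A <= open_content U)%E.
Proof. by move=> oU AU; apply: ereal_inf_lbound; exists U => //; split. Qed.

Let daniell_outer_ge0 A : (0 <= daniell_outer A)%E.
Proof. by apply: le_ereal_inf_tmp => _ [V _ <-]. Qed.

Let daniell_outer_fin A : daniell_outer A \is a fin_num.
Proof.
rewrite ge0_fin_numE//; apply: le_lt_trans (ltry 1).
apply: le_trans (open_content_le1 setT); apply: le_daniell_outer => //.
exact: openT.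
Qed.

Let daniell_outer0 : daniell_outer set0 = 0%E.
Proof.
rewrite daniell_outer_open; last exact: open0.
apply/eqP; rewrite eq_le open_content_ge0 andbT.
apply: ge_ereal_sup => _ [u [_ _ u0] <-]; rewrite (_ : u = 0) ?l0//.
by apply/funext => x; exact: u0.
Qed.

(** For fixed [n], [g n k] increases with [k] to the indicator of [U n]. The diagonal sums [s k]
    thus eventually exceed [u] at each point of the union, and the remainders [v k] of [u] after
    truncation by [s k] decrease to 0. By [l_decr] their contribution falls below any [e], while
    [l (s k)] is at most a partial sum of the series. *)
Let open_content_bigcup (U : nat -> set T) : (forall n, open (U n)) ->
  (open_content (\bigcup_n U n) <= \sum_(n <oo) open_content (U n))%E.
Proof.
move=> oU; apply: ge_ereal_sup => _ [u [Cu u01 uU] <-].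
have /choice[h hP] n := cozero (oU n).
pose g n k : T -> R := fun x => Num.min (k%:R * h n x) 1.
have g01 n k x : 0 <= g n k x <= 1.
  have [_ h0 _] := hP n.
  by rewrite /g ge_min lexx orbT le_min ler01 andbT mulr_ge0.
have Cg n k : Cb (g n k).
  apply: (@continuous_bounded_Cb _ _ 1) => //; have [ch _ _] := hP n.
  apply: continuous_min_fun; last by move=> x; exact: cvg_cst.
  by move=> x; apply: cvgMr; exact: ch.
have gU n k : subordinate (U n) (g n k).
  split => // x; have [_ h0 ->] := hP n => /= /negP; rewrite -leNgt => hx.
  have hx0 : h n x = 0 by apply/eqP; rewrite eq_le hx h0.
  by rewrite /g hx0 mulr0 min_l.
pose s k : T -> R := \sum_(n < k) g n k.
have sE k x : s k x = \sum_(n < k) g n k x by rewrite /s fct_sumE.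
have Cs k : Cb (s k) by exact: (@Cb_sum _ _ (g ^~ k)).
have s_ge0 k x : 0 <= s k x.
  by rewrite sE sumr_ge0// => i _; have /andP[] := g01 i k x.
have s_mono x : nondecreasing_seq (s ^~ x).
  apply/nondecreasing_seqP => k; rewrite !sE big_ord_recr /=.
  rewrite -[leLHS]addr0 lerD//; last by have /andP[] := g01 k k.+1 x.
  apply: ler_sum => i _; rewrite /g le_min !ge_min lexx orbT andbT.
  apply/orP; left; have [_ h0 _] := hP i.
  by rewrite ler_wpM2r// ler_nat.
pose v k : T -> R := u - (u \min s k).
have Cv k : Cb (v k) by apply: Cb_sub => //; exact: Cb_min.
have vE k x : v k x = u x - Num.min (u x) (s k x) by [].
have v_decr x : seq_decr_to (v ^~ x) 0.
  split.
    move=> m n mn; rewrite !vE lerD2l lerN2 le_min !ge_min lexx /=.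
    by rewrite s_mono ?orbT.
  apply: cvg_near_cst.
  have [[n _ Unx]|nUx] := pselect ((\bigcup_n U n) x); last first.
    by apply: nearW => k; rewrite vE uU// min_l ?subrr.
  have hx : 0 < h n x by move: Unx; have [_ _ ->] := hP n.
  near=> k; rewrite vE min_l ?subrr//.
  apply: (@le_trans _ _ 1); first by have /andP[] := u01 x.
  have nk : (n < k)%N by near: k; exact: nbhs_infty_gt.
  rewrite sE (bigD1 (Ordinal nk)) //=.
  rewrite -[leLHS]addr0 lerD//; last first.
    by rewrite sumr_ge0// => i _; have /andP[] := g01 i k x.
  rewrite /g le_min lexx andbT -ler_pdivrMr// div1r.
  by near: k; exact: nbhs_infty_ger.
have lv : l \o v @ \oo --> 0 by exact: l_decr.
apply/lee_addgt0Pr => e e0.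
have [k _ /(_ k (leqnn k)) /= lvk] : \forall k \near \oo, l (v k) < e.
  by move/cvgrPdist_lt : lv => /(_ _ e0); apply: filterS => k /=;
    rewrite sub0r normrN => /ltr_normlW.
have -> : u = v k + (u \min s k) by rewrite /v subrK.
rewrite lD//; last exact: Cb_min.
rewrite addrC EFinD leeD//; last by rewrite lee_fin ltW.
apply: (@le_trans _ _ (l (s k))%:E).
  rewrite lee_fin l_le//; first exact: Cb_min.
  by move=> x /=; rewrite ge_min lexx orbT.
rewrite (l_sum (F := g ^~ k))// -sumEFin.
apply: (@le_trans _ _ (\sum_(n < k) open_content (U n))%E).
  by apply: lee_sum => i _; exact: open_content_ub.
rewrite -(big_mkord xpredT (fun n => open_content (U n))).
exact: nneseries_lim_ge.
Unshelve. all: by end_near. Qed.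

Let daniell_outer_sigma_subadditive A (F : (set T)^nat) :
  subset_sigma_subadditive daniell_outer A F.
Proof.
move=> AF; apply/lee_addgt0Pr => e e0.
have eps n : 0 < e / (2 ^ n.+1)%:R by rewrite divr_gt0// ltr0n expn_gt0.
have /choice[U UP] n : exists U, [/\ open U, F n `<=` U &
    (open_content U <= daniell_outer (F n) + (e / (2 ^ n.+1)%:R)%:E)%E].
  have [_ [U [oU FU] <-] /ltW UF] :=
    lb_ereal_inf_adherent (eps n) (daniell_outer_fin (F n)).
  by exists U; split => //; exact: UF.
have oU n : open (U n) by have [] := UP n.
apply: (@le_trans _ _ (open_content (\bigcup_n U n))).
  apply: le_daniell_outer; first exact: bigcup_open.
  apply: (subset_trans AF) => x [n _ Fnx]; exists n => //.
  by have [_ + _] := UP n; exact.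
apply: (le_trans (open_content_bigcup oU)).
apply: le_trans (epsilon_trick xpredT _ _) => //; last exact: ltW.
by apply: lee_nneseries => // n _; have [] := UP n.
Qed.

(* Replacing [u] by [max (u - e) 0], which vanishes on the open set [W], leaves
   room to add a function subordinate to [W]. *)
Let open_caratheodory U : open U -> forall X,
  (daniell_outer (X `&` U) + daniell_outer (X `&` ~` U) <= daniell_outer X)%E.
Proof.
move=> oU X; apply: le_ereal_inf_tmp => _ [V [oV XV] <-].
have oVU : open (V `&` U) by exact: openI.
apply: (@le_trans _ _ (open_content (V `&` U) + daniell_outer (X `&` ~` U))%E).
  by rewrite leeD2r// le_daniell_outer// => x [/XV].
rewrite -leeBrDr//; apply: ge_ereal_sup => _ [u [Cu u01 uVU] <-].
rewrite leeBrDr//; apply/lee_addgt0Pr => e e0.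
have cu : continuous u by have [] := Cu.
pose W := V `&` [set x | u x < e].
have oW : open W.
  apply: openI => //; rewrite (_ : [set x | _] = u @^-1` [set y | y < e])//.
  by apply: open_comp; [move=> x _; exact: cu|exact: open_lt].
pose ue : T -> R := (u - cst e) \max 0.
have Cue : Cb ue.
  apply: Cb_max; last exact: Cb0.
  by apply: Cb_sub => //; exact: Cb_cst.
have ueE x : ue x = Num.max (u x - e) 0 by [].
have lue : l u <= l ue + e.
  apply: (@le_trans _ _ (l (ue + cst e))).
    apply: l_le => //; first by apply: Cb_add => //; exact: Cb_cst.
    move=> x; rewrite [leRHS](_ : _ = Num.max (u x - e) 0 + e)//.
    by rewrite -lerBlDr le_max lexx.
  rewrite lD//; last exact: Cb_cst.
  rewrite lerD2l (_ : cst e = e *: cst 1); last first.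
    by apply/funext => x; rewrite /= [RHS]mulr1.
  by rewrite lZ; [rewrite ler_piMr// ltW|exact: Cb_cst].
have XW : (daniell_outer (X `&` ~` U) <= open_content W)%E.
  apply: le_daniell_outer => // x [Xx nUx]; split; first exact: XV.
  by rewrite /= uVU// => -[].
apply: (@le_trans _ _ ((l ue + e)%:E + open_content W)%E).
  by rewrite leeD// lee_fin.
rewrite EFinD addeAC leeD2r// addeC -leeBrDr//.
apply: ge_ereal_sup => _ [g [Cg g01 gW] <-].
rewrite leeBrDr// -EFinD -lD//; apply: open_content_ub; split.
- exact: Cb_add.
- move=> x; rewrite [(g + ue) x](_ : _ = g x + Num.max (u x - e) 0)//.
  have /andP[g0 g1] := g01 x; have /andP[u0 u1] := u01 x.
  have [ux|ux] := ltP (u x) e.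
    by rewrite max_r ?addr0 ?g0// subr_le0 ltW.
  rewrite gW; last by case => _ /=; rewrite ltNge ux.
  by rewrite max_l ?subr_ge0// add0r subr_ge0 ux; lra.
- move=> x nVx; rewrite [(g + ue) x](_ : _ = g x + Num.max (u x - e) 0)//.
  rewrite gW; last by case.
  by rewrite uVU ?add0r ?max_r ?sub0r ?oppr_le0 ?ltW// => -[].
Qed.

Let daniell_outer_measure : {outer_measure set T -> \bar R} :=
  HB.pack daniell_outer (isSubsetOuterMeasure.Build R T daniell_outer
    daniell_outer0 daniell_outer_ge0 daniell_outer_sigma_subadditive).

Let borel_caratheodory (A : set (borelType T)) :
  measurable A -> daniell_outer_measure.-caratheodory A.
Proof.
apply: (@smallest_sub _ (sigma_algebra setT)).
  split; first exact: caratheodory_measurable_set0.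
  - by move=> B; rewrite setTD; exact: caratheodory_measurable_setC.
  - exact: caratheodory_measurable_bigcup.
move=> U oU; apply: le_caratheodory_measurable.
exact: open_caratheodory.
Qed.

Let daniell_sigma_additive :
  semi_sigma_additive (daniell_outer : set (borelType T) -> \bar R).
Proof.
move=> F mF tF mUF.
have := @caratheodory_measure_sigma_additive _ _ daniell_outer_measure F.
apply => //; first by move=> n; exact: borel_caratheodory.
exact: borel_caratheodory.
Qed.

Let daniell_le1 : (daniell_outer (setT : set (borelType T)) <= 1)%E.
Proof. by rewrite daniell_outer_open//; exact: openT. Qed.

Let Q0 : {measure set (borelType T) -> \bar R} :=
  HB.pack (daniell_outer : set (borelType T) -> \bar R)
    (isMeasure.Build _ (borelType T) R (daniell_outer : set (borelType T) -> \bar R)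
    daniell_outer0 daniell_outer_ge0 daniell_sigma_additive).

Let Q : subprobability (borelType T) R := subprobability_of (Q0 := Q0) daniell_le1.

Let QE U : open U -> Q U = open_content U.
Proof. exact: daniell_outer_open. Qed.

Let continuous_measurable u : continuous u ->
  measurable_fun setT (u : borelType T -> R).
Proof.
move=> cu; apply: (measurability _ (RGenOInfty.measurableE R)).
move=> _ [_ [a ->] <-]; rewrite setTI; apply: sub_sigma_algebra.
by apply: open_comp; [move=> x _; exact: cu|exact: interval_open].
Qed.

Let Cb_integrable u : Cb u -> Q.-integrable setT (EFin \o u).
Proof.
move=> Cu; apply: measurable_bounded_integrable => //.
- exact: le_lt_trans (@sprobability_setT _ _ _ Q) (ltry 1).
- by apply: continuous_measurable; case: Cu.
- by case: Cu.
Qed.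

Let I u : R := (\int[Q]_x u x)%R.

Let ID u v : Cb u -> Cb v -> I (u + v) = I u + I v.
Proof. by move=> Cu Cv; rewrite /I -RintegralD//; exact: Cb_integrable. Qed.

Let IZ c u : Cb u -> I (c *: u) = c * I u.
Proof. by move=> Cu; rewrite /I -RintegralZl//; exact: Cb_integrable. Qed.

(** Both sides are compared with the measure of the open set where [u] is positive: [u] is
    subordinate to it, and [v] dominates its indicator. *)
Let l_le_I_layer u v : Cb u -> Cb v -> (forall x, 0 <= u x <= 1) ->
  (forall x, 0 <= v x) -> (forall x, 0 < u x -> 1 <= v x) -> l u <= I v.
Proof.
move=> Cu Cv u01 v0 uv; pose U := [set x | 0 < u x].
have oU : open U.
  rewrite (_ : U = u @^-1` [set y | 0 < y])//.
  by apply: open_comp; [move=> x _; case: Cu => _; exact|exact: open_gt].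
have mU : measurable (U : set (borelType T)) by exact: sub_sigma_algebra.
have lU : ((l u)%:E <= Q U)%E.
  rewrite QE//; apply: open_content_ub; split => // x /negP; rewrite -leNgt.
  by move=> ux; apply/eqP; rewrite eq_le ux; have /andP[] := u01 x.
rewrite -lee_fin; apply: (le_trans lU).
rewrite -[U]setIT -integral_indic//.
have Iv := Cb_integrable Cv.
rewrite /I /Rintegral fineK; last exact: integrable_fin_num.
apply: ge0_le_integral => //.
- by apply/measurable_EFinP; exact: measurable_indic.
- by have /integrableP[] := Iv.
- move=> x _; rewrite lee_fin indicE; have [|_] := boolP (x \in U); last exact: v0.
  by rewrite inE => /uv.
Qed.

(* Slicing [v] into the layers [G j] between heights [j] and [j + 1], the form
   [l] on a layer is at most [I] on the layer below, so [l v <= 1 + I v] with an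
   error independent of [v]; it disappears by homogeneity. *)
Let l_le_I u : Cb u -> (forall x, 0 <= u x) -> l u <= I u.
Proof.
have l_le_I1 v : Cb v -> (forall x, 0 <= v x) -> l v <= 1 + I v.
  move=> Cv v0.
  pose F k : T -> R := v \min cst k%:R.
  have CF k : Cb (F k) by apply: Cb_min => //; exact: Cb_cst.
  have FE k x : F k x = Num.min (v x) k%:R by [].
  have lF k : l (F k.+1) <= 1 + I (F k).
    elim: k => [|k ih].
      have -> : F 0 = 0 by apply/funext => x; rewrite FE min_r.
      have := IZ 0 Cb0; rewrite scale0r mul0r => ->; rewrite addr0.
      apply: le_trans l_le1; apply: l_le => //; first exact: Cb_cst.
      by move=> x; rewrite FE ge_min lexx orbT.
    pose G j : T -> R := F j.+1 - F j.
    have CG j : Cb (G j) by exact: Cb_sub.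
    have GE j x : G j x = Num.min (v x) (j%:R + 1) - Num.min (v x) j%:R.
      by rewrite natr1.
    have FS j : F j.+1 = G j + F j by rewrite /G subrK.
    rewrite FS lD// [in leRHS]FS ID// addrCA lerD//.
    have G01 j x : 0 <= G j x <= 1.
      by rewrite GE; have [] := leP (v x) (j%:R + 1); have [] := leP (v x) j%:R; lra.
    apply: l_le_I_layer => // x; first by have /andP[] := G01 k x.
    rewrite !GE -natr1.
    by have [] := leP (v x) (k%:R + 1 + 1); have [] := leP (v x) (k%:R + 1);
      have [] := leP (v x) k%:R; lra.
  have /CbP[[M vM] _] := Cv.
  pose k := (Num.truncn M).+1.
  have FK j : (k <= j)%N -> F j = v.
    move=> kj; apply/funext => x; rewrite FE min_l//.
    apply: le_trans (ler_norm _) _; apply: le_trans (vM x) _.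
    by apply: le_trans (ltW (truncnS_gt _)) _; rewrite ler_nat.
  by have := lF k; rewrite !FK.
move=> Cu u0; apply/ler_addgt0Pl => e e0.
have k0 : 0 < e^-1 by rewrite invr_gt0.
have := l_le_I1 (e^-1 *: u) (Cb_scale _ Cu).
rewrite lZ// IZ// => /(_ (fun x => mulr_ge0 (ltW k0) (u0 x))).
move/(ler_wpM2l (ltW e0)).
by rewrite mulrDr mulr1 !mulrA mulfV ?gt_eqF// !mul1r.
Qed.

(** The bound [l_le_I] is one-sided and restricted to nonnegative functions. Since [l] and the
    integral agree on constants, applying it to [M + u] and to [M - u], where [M] bounds [u], gives
    both inequalities. *)
Theorem daniell_stone : exists P : subprobability (borelType T) R,
  forall u, Cb u -> (\int[P]_x (u x)%:E = (l u)%:E)%E.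
Proof.
exists Q => u Cu; have Iu := Cb_integrable Cu.
rewrite -[LHS]fineK; last exact: integrable_fin_num.
congr EFin; rewrite -[LHS]/(I u).
have /CbP[[M uM] _] := Cu.
have CM : Cb (cst M : T -> R) by exact: Cb_cst.
have lM : l (cst M) <= I (cst M).
  apply: l_le_I => // x /=; exact: le_trans (uM x).
have IM : I (cst M) <= l (cst M).
  have M0 : 0 <= M by apply: le_trans (uM point).
  have -> : cst M = M *: cst 1 :> (T -> R).
    by apply/funext => x; rewrite /= [RHS]mulr1.
  rewrite lZ ?IZ; [|exact: Cb_cst..]; apply: ler_wpM2l => //.
  rewrite /I Rintegral_cst// mul1r -lee_fin fineK; last exact: fin_num_measure.
  rewrite [leLHS](QE openT).
  apply: ge_ereal_sup => _ [v [Cv v01 _] <-]; rewrite lee_fin l_le//.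
    exact: Cb_cst.
  by move=> x; have /andP[] := v01 x.
have := l_le_I (Cb_add CM Cu); rewrite lD// ID//.
have := l_le_I (Cb_sub CM Cu); rewrite lB//.
rewrite -scaleN1r addrC ID ?IZ//; last exact: Cb_scale.
have h x : - M <= u x <= M by rewrite -ler_norml.
move=> h1 h2.
have {}h1 : l (cst M) - l u <= -1 * I u + I (cst M).
  by apply: h1 => x; rewrite [leRHS](_ : _ = -1 * u x + M)//; have := h x; lra.
have {}h2 : l (cst M) + l u <= I (cst M) + I u.
  apply: h2 => x; rewrite [leRHS](_ : _ = M + u x)//; have := h x; lra.
lra.
Qed.

End DaniellStone.

(** * Polish spaces and analytic sets *)

Section SubspaceMetric.
Context {R : realType} {M : metricType R} (A : set M).

Let sub_mdist (x y : set_type A) : R := mdist (\val x) (\val y).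

Let sub_mdist_ge0 x y : 0 <= sub_mdist x y.
Proof. exact: mdist_ge0. Qed.

Let sub_mdist_positivity x y : sub_mdist x y = 0 -> x = y.
Proof. by move/mdist_positivity/val_inj. Qed.

Let sub_ballEmdist (x : set_type A) (d : R) :
  ball x d = [set y | sub_mdist x y < d].
Proof. by rewrite -initial_ballE ballEmdist. Qed.

HB.instance Definition _ := PseudoMetric_isMetric.Build R (set_type A)
  sub_mdist_ge0 sub_mdist_positivity sub_ballEmdist.

End SubspaceMetric.

Section ProductMetric.
Context {R : realType} {M N : metricType R}.

Let prod_mdist (x y : M * N) : R := Num.max (mdist x.1 y.1) (mdist x.2 y.2).

Let prod_mdist_ge0 x y : 0 <= prod_mdist x y.
Proof. by rewrite /prod_mdist le_max mdist_ge0. Qed.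

Let prod_mdist_positivity x y : prod_mdist x y = 0 -> x = y.
Proof.
move=> xy; have : prod_mdist x y <= 0 by rewrite xy.
rewrite /prod_mdist ge_max => /andP[h1 h2].
rewrite [x]surjective_pairing [y]surjective_pairing; congr pair;
  by apply: mdist_positivity; apply/eqP; rewrite eq_le mdist_ge0 andbT.
Qed.

Let prod_ballEmdist (x : M * N) (d : R) :
  ball x d = [set y | prod_mdist x y < d].
Proof.
apply/seteqP; split => y /=; rewrite /prod_mdist gt_max.
  by move=> [] /=; rewrite !ballEmdist /= => -> ->.
by move=> /andP[h1 h2]; split; rewrite ballEmdist.
Qed.

HB.instance Definition _ := PseudoMetric_isMetric.Build R (M * N)%type
  prod_mdist_ge0 prod_mdist_positivity prod_ballEmdist.

End ProductMetric.

(* The library's pseudometric on [bool] has singleton balls even for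
   nonpositive radii, hence does not come from a distance. *)
Definition two_points (R : realType) : Type := bool.

Section TwoPoints.
Context {R : realType}.

HB.instance Definition _ := Choice.on (two_points R).

Let two_mdist (x y : two_points R) : R := (x != y)%:R.

Let two_mdistxx x : two_mdist x x = 0.
Proof. by rewrite /two_mdist eqxx. Qed.

Let two_mdist_positivity x y : two_mdist x y = 0 -> x = y.
Proof.
by rewrite /two_mdist; have [//|_ /eqP] := eqVneq x y; rewrite oner_eq0.
Qed.

Let two_mdist_sym x y : two_mdist x y = two_mdist y x.
Proof. by rewrite /two_mdist eq_sym. Qed.

Let two_mdist_triangle y x z : two_mdist x z <= two_mdist x y + two_mdist y z.
Proof.
rewrite /two_mdist -natrD ler_nat.
by have [->|] := eqVneq x y; [|have [->|] := eqVneq x z].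
Qed.

HB.instance Definition _ := isMetric.Build R (two_points R)
  two_mdistxx two_mdist_positivity two_mdist_sym two_mdist_triangle.

End TwoPoints.

Section CompleteSeparable.
Context {R : realType}.

(** Metric counterpart of [polish], for arguments with balls and Cauchy filters; [polishP] and
    [polish_complete_separable] pass between the two. *)
Definition complete_separable (M : metricType R) : Prop :=
  (exists2 S : set M, countable S & dense S) /\
  forall F : set_system M, ProperFilter F -> cauchy F -> exists x : M, F --> x.

Lemma dense_ballP (M : metricType R) (S : set M) :
  dense S <-> forall (x : M) (e : R), 0 < e -> exists2 s, S s & ball x e s.
Proof.
split=> [dS x e e0|dS O [x Ox] oO].
  have [|s [/interior_subset xs Ss]] := dS (interior (ball x e)) _ (open_interior _).
    by exists x; exact: nbhsx_ballx.
  by exists s.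
have /nbhs_ballP[e /= e0 eO] : nbhs x O by exact: open_nbhs_nbhs.
by have [s Ss /eO Os] := dS x e e0; exists s.
Qed.

Lemma polishP (T : topologicalType) : polish R T ->
  exists (M : metricType R) (f : T -> M) (g : M -> T),
    [/\ complete_separable M, cancel f g, cancel g f, continuous f & continuous g].
Proof.
move=> [[S cS dS] [M [f [g [fK gK cf cg M_complete]]]]].
exists M, f, g; split => //; split => //.
exists (f @` S); first exact: (card_le_trans (card_image_le _ _)).
move=> O [x Ox] oO; have [||y [Oy Sy]] := dS (f @^-1` O).
- by exists (g x); rewrite /preimage /= gK.
- by apply: open_comp => // y _; exact: cf.
- by exists (f y); split => //; exists y.
Qed.

Lemma polish_complete_separable (M : metricType R) :
  complete_separable M -> polish R M.
Proof.
move=> [M_sep M_complete]; split => //; exists M, id, id; split => //.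
- by move=> x; exact: cvg_id.
- by move=> x; exact: cvg_id.
Qed.

Lemma analyticP (T : topologicalType) (A : set T) : analytic R A <->
  exists (M : metricType R) (f : M -> T),
    [/\ complete_separable M, continuous f & range f = A].
Proof.
split=> [[Y [f [/polishP[M [h [g [Mcs hK gK ch cg]]]] cf fA]]]|]; last first.
  move=> [M [f [Mcs cf fA]]]; exists M, f; split => //.
  exact: polish_complete_separable.
exists M, (f \o g); split => //.
  by move=> x; apply: continuous_comp; [exact: cg|exact: cf].
rewrite -fA; apply/seteqP; split => [_ [x _ <-]|_ [y _ <-]].
  by exists (g x).
by exists (h y); rewrite //= hK.
Qed.

Lemma complete_separable_closed (M : metricType R) (A : set M) :
  complete_separable M -> closed A -> complete_separable (set_type A).
Proof.
move=> [[S cS /dense_ballP dS] M_complete] cA; split.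
  have [[a0]|A0] := pselect (exists a : set_type A, True); last first.
    by exists set0 => // O [x _]; exfalso; apply: A0; exists x.
  (* The dense set [S] may miss [A]. For each of its points and each radius [1 / (n + 1)], one point
     of [A] within that radius is retained, with [a0] as default when there is none. *)
  pose pick (sn : M * nat) : set_type A :=
    xget a0 [set a | ball sn.1 sn.2.+1%:R^-1 (\val a)].
  exists (pick @` (S `*` setT)).
    apply: card_le_trans (card_image_le _ _) _.
    exact: countableX.
  apply/dense_ballP => x e e0.
  have [n ne] : exists n, n.+1%:R^-1 < e / 2.
    have e20 : 0 < e / 2 by rewrite divr_gt0.
    exists (Num.truncn (e / 2)^-1); rewrite invf_plt ?posrE// truncnS_gt//.
  have [s Ss xs] := dS (\val x) n.+1%:R^-1 (ltac:(by rewrite invr_gt0)).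
  exists (pick (s, n)); first by exists (s, n).
  rewrite -initial_ballE /=.
  apply: (@le_ball _ _ _ (n.+1%:R^-1 + n.+1%:R^-1)).
    by rewrite [leRHS]splitr lerD // ltW.
  apply: (ball_triangle xs).
  by rewrite /pick; case: xgetP => [a -> //|/(_ x)]; case; exact: (ball_sym xs).
move=> F FF /cauchy_ballP Fc.
have vFP : ProperFilter (\val @ F) by exact: fmap_proper_filter.
have [|x Fx] := M_complete (\val @ F) _.
  apply/cauchy_ballP => e e0; have := Fc e e0.
  move=> [[U V] [FU FV] UV].
  exists ((\val @` U), (\val @` V)) => /=.
    by split; [apply: filterS FU|apply: filterS FV] => y ? /=; exists y.
  by move=> [_ _] [/= [u Uu <-] [v Vv <-]]; have := UV (u, v) (conj Uu Vv).
have Ax : A x.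
  apply: (@closed_cvg _ _ F _ \val A cA _ x Fx).
  by apply: nearW => y; exact: set_valP.
exists (SigSub (mem_set Ax)).
apply/fcvg_ballP => e e0.
have /cvg_ballP/(_ _ e0) := Fx.
by apply: filterS => y.
Qed.

Lemma complete_separable_prod (M N : metricType R) :
  complete_separable M -> complete_separable N -> complete_separable (M * N)%type.
Proof.
move=> [[S cS /dense_ballP dS] M_complete] [[S' cS' /dense_ballP dS'] N_complete].
split.
  exists (S `*` S'); first exact: countableX.
  apply/dense_ballP => -[x y] e e0.
  have [s Ss xs] := dS x e e0; have [s' Ss' ys'] := dS' y e e0.
  by exists (s, s').
move=> F FF /cauchy_ballP Fc.
have F1 : ProperFilter (fst @ F) by exact: fmap_proper_filter.
have F2 : ProperFilter (snd @ F) by exact: fmap_proper_filter.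
have [|x Fx] := M_complete (fst @ F) _.
  apply/cauchy_ballP => e e0; have [[U V] [FU FV] UV] := Fc e e0.
  exists ((fst @` U), (fst @` V)) => /=.
    by split; [apply: filterS FU|apply: filterS FV] => y ? /=; exists y.
  by move=> [_ _] [/= [u Uu <-] [v Vv <-]]; have [] := UV (u, v) (conj Uu Vv).
have [|y Fy] := N_complete (snd @ F) _.
  apply/cauchy_ballP => e e0; have [[U V] [FU FV] UV] := Fc e e0.
  exists ((snd @` U), (snd @` V)) => /=.
    by split; [apply: filterS FU|apply: filterS FV] => z ? /=; exists z.
  by move=> [_ _] [/= [u Uu <-] [v Vv <-]]; have [] := UV (u, v) (conj Uu Vv).
exists (x, y); apply/fcvg_ballP => e e0.
have /cvg_ballP/(_ _ e0) h1 := Fx; have /cvg_ballP/(_ _ e0) h2 := Fy.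
by apply: filterS2 h1 h2 => z.
Qed.

Lemma two_pointsE (b c : two_points R) : ball b 1 c -> b = c.
Proof.
rewrite ballEmdist /= /mdist /=; have [//|_] := eqVneq b c.
by rewrite ltxx.
Qed.

Lemma complete_separable_two_points : complete_separable (two_points R).
Proof.
split.
  exists setT; last by move=> O [x Ox] _; exists x.
  exact: (@countableP bool).
move=> F FF /cauchy_ballP/(_ _ ltr01)[[U V] [FU FV] UV].
have [b Ub] := filter_ex FU.
exists b; apply/fcvg_ballP => e e0.
apply: filterS FV => c Vc.
have /two_pointsE/= <- := UV (b, c) (conj Ub Vc).
exact: ballxx.
Qed.

End CompleteSeparable.

Section Analytic.
Context {R : realType} {T : topologicalType}.

Lemma analytic_image (M : metricType R) (f : M -> T) (B : set M) :
  complete_separable M -> continuous f -> closed B -> analytic R (f @` B).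
Proof.
move=> Mcs cf cB; apply/analyticP; exists (set_type B), (f \o \val); split.
- exact: complete_separable_closed.
- by move=> x; apply: continuous_comp; [exact: initial_continuous|exact: cf].
- apply/seteqP; split => [_ [x _ <-]|_ [x Bx <-]].
    by exists (\val x) => //; exact: set_valP.
  by exists (SigSub (mem_set Bx)).
Qed.

Lemma analytic_set0 : analytic R (set0 : set T).
Proof.
exists (set_type (set0 : set (two_points R))), (fun x => False_rect T (set_mem (valP x))).
split.
- apply/polish_complete_separable/complete_separable_closed.
    exact: complete_separable_two_points.
  exact: closed0.
- by move=> x; have := set_mem (valP x).
- by apply/seteqP; split => // y [x]; have := set_mem (valP x).
Qed.

Lemma analytic_closed (A : set T) : polish R T -> closed A -> analytic R A.
Proof.
move=> /polishP[M [f [g [Mcs fK gK cf cg]]]] cA.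
rewrite (_ : A = g @` (g @^-1` A)).
  apply: analytic_image => //; apply: preimage_closed cA => x _; exact: cg.
by apply/seteqP; split => [x Ax|_ [x ? <-]//]; exists (f x); rewrite /preimage /= fK.
Qed.

Lemma analytic_comp (U : topologicalType) (f : T -> U) (A : set T) :
  continuous f -> analytic R A -> analytic R (f @` A).
Proof.
move=> cf [Y [h [Ypol ch <-]]]; exists Y, (f \o h); split => //.
  by move=> x; apply: continuous_comp; [exact: ch|exact: cf].
by rewrite image_comp.
Qed.

(* If [A] and [B] are the ranges of [f] and [g], their union is the range of
   [(b, x, y) |-> if b then f x else g y], as long as both are nonempty. *)
Lemma analytic_setU (A B : set T) :
  analytic R A -> analytic R B -> analytic R (A `|` B).
Proof.
move=> aA aB.
have [->|/set0P[a Aa]] := eqVneq A set0; first by rewrite set0U.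
have [->|/set0P[b Bb]] := eqVneq B set0; first by rewrite setU0.
have /analyticP[M [f [Mcs cf fA]]] := aA.
have /analyticP[N [g [Ncs cg gB]]] := aB.
apply/analyticP; exists ((two_points R * M) * N)%type.
exists (fun z => if z.1.1 : bool then f z.1.2 else g z.2); split.
- apply: complete_separable_prod Ncs; apply: complete_separable_prod Mcs.
  exact: complete_separable_two_points.
- move=> [[c x] y].
  (* Points at distance less than 1 have the same first coordinate, so the map coincides near
     [(c, x, y)] with the single branch [h] selected by [c]. *)
  pose h (z : (two_points R * M) * N) := if (c : bool) then f z.1.2 else g z.2.
  have ch : continuous h.
    rewrite /h; case: (c) => z.
      apply: continuous_comp; last exact: cf.
      by apply: continuous_comp; [exact: cvg_fst|exact: cvg_snd].
    by apply: continuous_comp; [exact: cvg_snd|exact: cg].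
  have := ch (c, x, y); rewrite /continuous_at /h /=; apply: cvg_trans.
  apply: near_eq_cvg.
  have : nbhs (c, x, y) (ball ((c, x, y) : (two_points R * M) * N) 1) by exact: nbhsx_ballx.
  by apply: filterS => -[[c' x'] y'] [[/two_pointsE /= <-]].
- rewrite -fA -gB; apply/seteqP; split => [_ [[[[] x] y] _ <-]|z] /=.
  + by left; exists x.
  + by right; exists y.
  + move: Aa Bb; rewrite -fA -gB => -[x _ _] [y _ _].
    by move=> [[x' _ <-]|[y' _ <-]]; [exists (true, x', y)|exists (false, x, y')].
Qed.

End Analytic.

(** * Lipschitz envelopes and suprema over fibers *)

Section LipschitzEnvelope.
Context {R : realType} {M : metricType R}.
Variables (a b : R) (S : set (M * R)) (k : R).
Hypothesis S_le : forall z, S z -> z.2 <= b.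
Hypothesis k_ge0 : 0 <= k.

(** McShane's formula for the least [k]-Lipschitz function that is at least [a] and passes on or
    above every point of [S]. *)
Definition lipschitz_envelope (x : M) : R :=
  sup ([set a] `|` [set z.2 - k * mdist z.1 x | z in S]).

Lemma lipschitz_envelope_le x c : a <= c ->
  (forall z, S z -> z.2 - k * mdist z.1 x <= c) -> lipschitz_envelope x <= c.
Proof.
move=> ac Sc; apply: ge_sup; first by exists a; left.
by move=> _ [->//|[z Sz <-]]; exact: Sc.
Qed.

Let envelope_set_le x y :
  ([set a] `|` [set z.2 - k * mdist z.1 x | z in S]) y -> y <= Num.max a b.
Proof.
move=> [->|[z Sz <-]]; first by rewrite le_max lexx.
rewrite le_max; apply/orP; right.
by rewrite lerBlDr (le_trans (S_le Sz))// lerDl mulr_ge0// mdist_ge0.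
Qed.

Lemma lipschitz_envelope_ge x : a <= lipschitz_envelope x.
Proof.
by apply: ub_le_sup; [exists (Num.max a b) => y /envelope_set_le|left].
Qed.

Lemma lipschitz_envelope_ub x z :
  S z -> z.2 - k * mdist z.1 x <= lipschitz_envelope x.
Proof.
move=> Sz; apply: ub_le_sup; first by exists (Num.max a b) => y /envelope_set_le.
by right; exists z.
Qed.

Lemma lipschitz_envelope_le_max x : lipschitz_envelope x <= Num.max a b.
Proof.
by apply: ge_sup => [|y /envelope_set_le//]; exists a; left.
Qed.

Lemma lipschitz_envelope_lipschitz x y :
  lipschitz_envelope x <= lipschitz_envelope y + k * mdist x y.
Proof.
apply: lipschitz_envelope_le => [|z Sz].
  by rewrite -[leLHS]addr0 lerD ?lipschitz_envelope_ge// mulr_ge0// mdist_ge0.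
have := lipschitz_envelope_ub y Sz.
have := ler_wpM2l k_ge0 (metric_triangle z.1 x y).
by rewrite mulrDr; lra.
Qed.

Lemma continuous_lipschitz_envelope : continuous lipschitz_envelope.
Proof.
move=> x; apply/cvgrPdist_lt => e e0.
(* The constant [k] may vanish, hence the radius [e / (k + 1)]. *)
have k1 : 0 < k + 1 by exact: ltr_wpDl.
have ke0 : 0 < e / (k + 1) by rewrite divr_gt0.
have : nbhs x (ball x (e / (k + 1))) by exact: nbhsx_ballx.
apply: filterS => y; rewrite ballEmdist /= => xy.
have kxy : k * mdist x y < e.
  rewrite ltr_pdivlMr// in xy.
  by have := mdist_ge0 x y; lra.
have h1 := lipschitz_envelope_lipschitz x y.
have h2 := lipschitz_envelope_lipschitz y x.
rewrite [mdist y x]metric_sym in h2.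
by rewrite ltr_norml; apply/andP; split; lra.
Qed.

End LipschitzEnvelope.

(** Here [1 - d] is the distance to the complement of [U], truncated at 1: [d] is the 1-Lipschitz
    envelope of the indicator of that complement. *)
Lemma polish_cozero (R : realType) (T : topologicalType) : polish R T ->
  forall U : set T, open U -> exists h : T -> R,
    [/\ continuous h, forall x, 0 <= h x & U = [set x | 0 < h x]].
Proof.
move=> /polishP[M [f [g [Mcs fK gK cf cg]]]] U oU.
pose S : set (M * R) := [set z | ~ U (g z.1) /\ z.2 = 1].
pose d := lipschitz_envelope 0 S 1.
have S1 z : S z -> z.2 <= 1 by move=> [_ ->].
have d_ge0 x : 0 <= d x by exact: (lipschitz_envelope_ge 0 S1 ler01).
have d_le1 x : d x <= 1.
  by apply: le_trans (lipschitz_envelope_le_max 0 S1 ler01 x) _; rewrite max_r.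
have cd : continuous d by exact: (continuous_lipschitz_envelope S1 ler01).
exists (fun x => 1 - d (f x)); split.
- move=> x; apply: cvgB; first exact: cvg_cst.
  by apply: continuous_comp; [exact: cf|exact: cd].
- by move=> x; rewrite subr_ge0.
- apply/seteqP; split => x /=; rewrite subr_gt0; last first.
    apply: contraPP => nUx; apply/negP; rewrite -leNgt.
    have /(lipschitz_envelope_ub 0 S1 ler01 (f x)) : S (f x, 1).
      by split; rewrite //= fK.
    by rewrite /= mdistxx mulr0 subr0.
  move=> Ux; have /nbhs_ballP[e /= e0 eU] : nbhs (f x) (g @^-1` U).
    by apply: cg; rewrite fK; exact: open_nbhs_nbhs.
  apply: (@le_lt_trans _ _ (Num.max 0 (1 - e))); last first.
    by rewrite gt_max ltr01 /=; lra.
  apply: lipschitz_envelope_le; first by rewrite le_max lexx.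
  move=> z [nUz ->]; rewrite le_max; apply/orP; right.
  rewrite mul1r lerD2l lerN2 leNgt; apply/negP => zx; apply: nUz.
  by apply: eU; rewrite ballEmdist /= metric_sym.
Qed.

Lemma Cb_USAb (R : realType) (T : topologicalType) (phi : T -> R) :
  polish R T -> Cb phi -> USAb phi.
Proof.
move=> Tpol [bphi cphi]; split => // t; apply: analytic_closed => //.
rewrite (_ : [set x | _] = phi @^-1` [set y | t <= y])//.
by apply: preimage_closed => [x _|]; [exact: cphi|exact: closed_ge].
Qed.

Section SetEnvelope.
Context {R : realType} {Y T : Type} (a b : R) (f : Y -> T) (tau : Y -> R).
Hypothesis tau_le : forall y, tau y <= b.
Hypothesis a_le_b : a <= b.

(** Intended for the coordinates [f] and [tau] of a parametrized subset of [T * R]. Composed with an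
    expectation, it is a function of the parameter set [B] that plays the role of the capacity in
    Choquet's argument. *)
Definition fiber_sup (B : set Y) (x : T) : R :=
  sup ([set a] `|` [set tau y | y in B `&` [set y | f y = x]]).

Lemma fiber_sup_le B x c : a <= c ->
  (forall y, B y -> f y = x -> tau y <= c) -> fiber_sup B x <= c.
Proof.
move=> ac Bc; apply: ge_sup; first by exists a; left.
by move=> _ [->//|[y [By yx] <-]]; exact: Bc.
Qed.

Let fiber_set_ub B x :
  has_ubound ([set a] `|` [set tau y | y in B `&` [set y | f y = x]]).
Proof. by exists b => _ [->//|[y _ <-]]. Qed.

Lemma fiber_sup_ge B x : a <= fiber_sup B x.
Proof. by apply: ub_le_sup => //; left. Qed.

Lemma fiber_sup_ub B y : B y -> tau y <= fiber_sup B (f y).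
Proof. by move=> By; apply: ub_le_sup => //; right; exists y. Qed.

Lemma fiber_sup_leb B x : fiber_sup B x <= b.
Proof. exact: fiber_sup_le. Qed.

Lemma le_fiber_sup B B' x : B `<=` B' -> fiber_sup B x <= fiber_sup B' x.
Proof.
move=> BB'; apply: fiber_sup_le; first exact: fiber_sup_ge.
by move=> y /BB' By <-; exact: fiber_sup_ub.
Qed.

Lemma fiber_sup_cvg (B : set Y) (C : nat -> set Y) :
  (forall m n, (m <= n)%N -> C m `<=` C n) -> (forall y, exists n, C n y) ->
  forall x, seq_incr_to (fun n => fiber_sup (B `&` C n) x) (fiber_sup B x).
Proof.
move=> C_incr C_cover x; split.
  by move=> m n mn; apply: le_fiber_sup => y [By Cy]; split => //; exact: C_incr Cy.
have sub n : fiber_sup (B `&` C n) x <= fiber_sup B x.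
  by apply: le_fiber_sup => y [].
suff near_sup e : 0 < e -> exists n, fiber_sup B x - e < fiber_sup (B `&` C n) x.
  apply/cvgrPdist_lt => e /near_sup[n nP].
  near=> m; rewrite ger0_norm ?subr_ge0// ltrBlDr -ltrBlDl.
  apply: (lt_le_trans nP); apply: le_fiber_sup => y [By Cy]; split => //.
  by apply: C_incr Cy; near: m; exact: nbhs_infty_ge.
move=> e0.
have [|z [->|[y [By /= yx] <-]] zP] := @sup_adherent _ _ e e0
    (conj _ (fiber_set_ub B x)).
- by exists a; left.
- by exists 0; apply: (lt_le_trans zP); exact: fiber_sup_ge.
- have [n Cy] := C_cover y; exists n; apply: (lt_le_trans zP).
  by rewrite -yx; exact: fiber_sup_ub.
Unshelve. all: by end_near. Qed.

(* When the values of [tau] do not accumulate from below, suprema over fibers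
   are attained. *)
Lemma fiber_sup_attained :
  (forall t, exists2 t', t' < t & forall y, tau y < t -> tau y <= t') ->
  forall B t, a < t ->
    [set x | t <= fiber_sup B x] = f @` (B `&` [set y | t <= tau y]).
Proof.
move=> gap B t t_gt; apply/seteqP; split => [x /= tx|_ [y [By ty] <-]]; last first.
  exact: le_trans (fiber_sup_ub _).
apply: contrapT => nx; have [t' t't t'P] := gap t.
suff : fiber_sup B x <= Num.max a t'.
  by apply/negP; rewrite -ltNge; apply: lt_le_trans tx; rewrite gt_max t_gt.
apply: fiber_sup_le; first by rewrite le_max lexx.
move=> y By yx; rewrite le_max; apply/orP; right; apply: t'P.
by rewrite ltNge; apply/negP => ty; apply: nx; exists y.
Qed.

End SetEnvelope.

(** * Capacitability *)

Section Capacitability.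
Context {R : realType}.

Lemma closed_mdist_le (M : metricType R) (x : M) (e : R) :
  closed [set y | mdist x y <= e].
Proof.
move=> y cy; apply/ler_addgt0Pl => d d0.
have [z [/= xz]] := cy _ (nbhsx_ballx y d d0).
rewrite ballEmdist /= metric_sym => zy.
by apply: le_trans (metric_triangle x z y) _; lra.
Qed.

Lemma separable_sequence (M : metricType R) (x0 : M) :
  (exists2 S : set M, countable S & dense S) ->
  exists s : nat -> M, forall x (e : R), 0 < e -> exists n, ball x e (s n).
Proof.
move=> [S /countable_injP[r r_inj] /dense_ballP dS].
exists (fun n => xget x0 [set y | S y /\ r y = n]) => x e e0.
have [y Sy xy] := dS x e e0; exists (r y).
case: xgetP => [z _ [Sz rz]|/(_ y)]; last by case.
by rewrite (r_inj z y) ?inE.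
Qed.

Lemma ultrafilter_finite_cover (T : Type) (G : set_system T) (A : nat -> set T) m :
  UltraFilter G -> G [set y | exists2 j, (j < m)%N & A j y] -> exists j, G (A j).
Proof.
move=> GU; elim: m => [|m ih] GA.
  have [y [//]] : [set y | exists2 j, (j < 0)%N & A j y] !=set0 by exact: filter_ex GA.
have [GAm|GnAm] := in_ultra_setVsetC (A m) GU; first by exists m.
apply: ih; apply: filterS2 GA GnAm => y [j]; rewrite ltnS leq_eqVlt.
by move=> /orP[/eqP ->//|jm Aj _]; exists j.
Qed.

(** Replaces the extraction of a convergent subsequence. An ultrafilter finer than the tails of [y_]
    contains, for every [k], one of the finitely many closed balls of radius [1 / (k + 1)] covering
    a tail; hence it is Cauchy and converges. *)
Lemma totally_bounded_cluster (M : metricType R) (s y_ : nat -> M) (m : nat -> nat) :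
  complete_separable M ->
  (forall k i, (k < i)%N ->
    exists2 j, (j < m k)%N & mdist (s j) (y_ i) <= k.+1%:R^-1) ->
  exists (y : M) (G : set_system M),
    [/\ ProperFilter G, G --> y & forall A, (\forall i \near \oo, A (y_ i)) -> G A].
Proof.
move=> [_ M_complete] y_tb.
have yP : ProperFilter (y_ @ \oo) by exact: fmap_proper_filter.
have [G [GU Gy]] := ultraFilterLemma yP.
have GP : ProperFilter G by exact: ultra_proper.
suff /(M_complete G GP)[y Gy'] : cauchy G by exists y, G; split.
apply/cauchy_ballP => e e0.
have e20 : 0 < e / 2 by rewrite divr_gt0.
pose k := Num.truncn (e / 2)^-1.
have ke : k.+1%:R^-1 < e / 2 by rewrite invf_plt ?posrE// truncnS_gt.
have [j Gj] : exists j, G [set y | mdist (s j) y <= k.+1%:R^-1].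
  apply: (@ultrafilter_finite_cover _ G
    (fun j => [set y | mdist (s j) y <= k.+1%:R^-1]) (m k)) => //.
  by apply: Gy; exists k.+1 => // i /= ki; exact: y_tb.
exists ([set y | mdist (s j) y <= k.+1%:R^-1], [set y | mdist (s j) y <= k.+1%:R^-1]) => //.
move=> [y z] /= [jy jz]; rewrite ballEmdist /=.
apply: le_lt_trans (metric_triangle y (s j) z) _.
rewrite [mdist y _]metric_sym [ltRHS]splitr.
by rewrite ltrD// (le_lt_trans _ ke).
Qed.

Context {T : topologicalType} (T_polish : polish R T).
Variable E : (T -> R) -> R.
Hypothesis pcpE : PCP_convex_expectation E.

Section FiberSup.
Context {M : metricType R} (f : M -> T) (tau : M -> R) (a b : R) (y0 : M).
Hypothesis M_cs : complete_separable M.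
Hypothesis cf : continuous f.
Hypothesis ctau : continuous tau.
Hypothesis tau_le : forall y, tau y <= b.
Hypothesis ab : a <= b.
Hypothesis gap :
  forall t, exists2 t', t' < t & forall y, tau y < t -> tau y <= t'.

Let bounded_ab (phi : T -> R) : (forall x, a <= phi x <= b) -> bounded_fun phi.
Proof.
move=> phiab; apply/bounded_funE; exists (Num.max `|a| `|b|) => x.
have /andP[ax xb] := phiab x; rewrite le_max.
have [p0|p0] := leP 0 (phi x).
  by apply/orP; right; rewrite !ger0_norm//; exact: le_trans xb.
by apply/orP; left; rewrite !ltr0_norm ?lerN2//; exact: le_lt_trans p0.
Qed.

(** By [gap] the suprema are attained, so a superlevel set at a height above [a] is the continuous
    image of one closed set; lower superlevel sets are the whole space. *)
Lemma fiber_sup_USAb B : closed B -> USAb (fiber_sup a f tau B).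
Proof.
move=> cB; split.
  apply: bounded_ab => x; rewrite (fiber_sup_ge f tau_le ab)/=.
  exact: (fiber_sup_leb f tau_le ab).
move=> t; have [ta|at_] := leP t a.
  rewrite (_ : [set x | _] = setT); first exact/analytic_closed/closedT.
  by apply/seteqP; split => // x _; apply: le_trans ta _; exact: (fiber_sup_ge f tau_le ab).
rewrite (fiber_sup_attained f tau_le ab gap)//.
apply: analytic_image => //; apply: closedI => //.
rewrite (_ : [set y | _] = tau @^-1` [set y | t <= y])//.
by apply: preimage_closed => [x _|]; [exact: ctau|exact: closed_ge].
Qed.

(* Choquet's argument: [B k] keeps only the points that lie, for each [i < k],
   in finitely many balls of radius [1 / (i + 1)], where the number of balls is
   so large that [r < E (fiber_sup a f tau (B k))] by continuity from below. The
   functions [psi_ k >= fiber_sup a f tau (B k)] are [k]-Lipschitz, and by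
   compactness of the intersection of the [B k] their limit is below the
   original function. *)
Lemma fiber_sup_capacitable r : r < E (fiber_sup a f tau setT) ->
  exists (psi : T -> R) (psi_ : nat -> T -> R),
  [/\ forall k, Cb (psi_ k), forall x, seq_decr_to (psi_ ^~ x) (psi x),
      USAb psi, forall x, psi x <= fiber_sup a f tau setT x & r <= E psi].
Proof.
move=> rE; have [s s_dense] := separable_sequence y0 M_cs.1.
pose C k m : set M := [set y | exists2 j, (j < m)%N & mdist (s j) y <= k.+1%:R^-1].
have closedC k m : closed (C k m).
  rewrite (_ : C k m = \bigcup_(j in `I_m) [set y | mdist (s j) y <= k.+1%:R^-1])//.
  by apply: closed_bigcup => // j _; exact: closed_mdist_le.
have C_incr k m n : (m <= n)%N -> C k m `<=` C k n.
  by move=> mn y [j jm jy]; exists j => //; exact: leq_trans mn.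
have C_cover k y : exists n, C k n y.
  have [j] := s_dense y k.+1%:R^-1 (ltac:(by rewrite invr_gt0)).
  by rewrite ballEmdist /= metric_sym => /ltW jy; exists j.+1, j.
(* The conditions on [kB.2] sit inside the choice because [B] is defined by recursion through [next]
   before they can be proved for it. *)
have /choice[next nextP] (kB : nat * set M) : exists m : nat,
    closed kB.2 -> r < E (fiber_sup a f tau kB.2) ->
    r < E (fiber_sup a f tau (kB.2 `&` C kB.1 m)).
  have [[cB rB]|nB] := pselect (closed kB.2 /\ r < E (fiber_sup a f tau kB.2)); last first.
    by exists 0 => cB rB; exfalso; exact: nB.
  have [_ /cvgr_gt /(_ r rB)[n _ nP]] := pcp_incr pcpE (fiber_sup_USAb cB)
    (fun n => fiber_sup_USAb (closedI cB (closedC kB.1 n)))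
    (fiber_sup_cvg f tau_le ab kB.2 (C_incr kB.1) (C_cover kB.1)).
  by exists n => _ _; exact: (nP n (leqnn n)).
pose B := fix B k := if k is k'.+1 then B k' `&` C k' (next (k', B k')) else setT.
pose m k := next (k, B k).
have BS k : B k.+1 = B k `&` C k (m k) by [].
have BP k : closed (B k) /\ r < E (fiber_sup a f tau (B k)).
  elim: k => [|k [cB rB]]; first by split => //; exact: closedT.
  by rewrite BS; split; [exact: closedI|exact: (nextP (k, B k))].
have B_decr i j : (i <= j)%N -> B j `<=` B i.
  elim: j => [|j ih]; first by rewrite leqn0 => /eqP ->.
  rewrite leq_eqVlt => /orP[/eqP ->//|]; rewrite ltnS => /ih.
  by move=> Bji y [/Bji].
have BC k i y : (k < i)%N -> B i y -> C k (m k) y.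
  by move=> ki /(B_decr _ _ ki)[].
have [N [h [g [N_cs hK gK ch cg]]]] := polishP T_polish.
pose S k : set (N * R) := [set (h (f y), tau y) | y in B k].
have S_le k z : S k z -> z.2 <= b by move=> [y _ <-]; exact: tau_le.
pose psi_ k x := lipschitz_envelope a (S k) k%:R (h x).
have psi_ge k x : a <= psi_ k x by exact: (lipschitz_envelope_ge a (S_le k) (ler0n _ k)).
have psi_le k x : psi_ k x <= b.
  apply: le_trans (lipschitz_envelope_le_max a (S_le k) (ler0n _ k) _) _.
  by rewrite max_r.
have psi_ub k y x : B k y -> tau y - k%:R * mdist (h (f y)) (h x) <= psi_ k x.
  move=> By; apply: (lipschitz_envelope_ub a (S_le k) (ler0n _ k) _ (z := (h (f y), tau y))).
  by exists y.
have Cpsi k : Cb (psi_ k).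
  split; first by apply: bounded_ab => x; rewrite psi_ge psi_le.
  move=> x; apply: continuous_comp; first exact: ch.
  exact: (continuous_lipschitz_envelope (S_le k) (ler0n _ k)).
(* Passing from [i] to [j] lowers the envelope twice: [S j] is a subset of [S i], and the slope is
   steeper. *)
have psi_decr x : nonincreasing_seq (psi_ ^~ x).
  move=> i j ij; apply: lipschitz_envelope_le; first exact: psi_ge.
  move=> _ [y /(B_decr _ _ ij) By <-] /=; apply: le_trans (psi_ub i y x By).
  by rewrite lerD2l lerN2 ler_wpM2r ?mdist_ge0// ler_nat.
have psi_lb x : has_lbound (range (psi_ ^~ x)) by exists a => _ [k _ <-].
pose psi x := inf (range (psi_ ^~ x)).
have psi_cvg x : seq_decr_to (psi_ ^~ x) (psi x).
  by split => //; exact: nonincreasing_cvgn.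
have psi_inf x k : psi x <= psi_ k x by apply: ge_inf => //; exists k.
have psi_glb x c : (forall k, c <= psi_ k x) -> c <= psi x.
  by move=> cP; apply: lb_le_inf => [|_ [k _ <-]//]; exists (psi_ 0 x), 0.
have psi_USAb : USAb psi.
  split.
    apply: bounded_ab => x; rewrite psi_glb//=; exact: le_trans (psi_inf x 0) _.
  move=> t; apply: analytic_closed => //.
  rewrite (_ : [set x | _] = \bigcap_k (psi_ k) @^-1` [set y | t <= y]).
    apply: closed_bigI => k _; have [_ cpsi] := Cpsi k.
    by apply: preimage_closed => [x _|]; [exact: cpsi|exact: closed_ge].
  apply/seteqP; split => x /= tx; first by move=> k _; exact: le_trans (psi_inf x k).
  by apply: psi_glb => k; exact: tx.
exists psi, psi_; split => //.
- move=> x; rewrite leNgt; apply/negP.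
  set v := fiber_sup a f tau setT x => vpsi.
  (* Since [rho] exceeds the floor [a], the inequality [rho < psi_ k x] has a witness in [B k]. The
     witnesses cluster at some [y]: the penalty, at most [b - rho], forces [f y = x], and
     [tau y >= rho > v] contradicts the definition of [v]. *)
  pose rho := (v + psi x) / 2.
  have vrho : v < rho by rewrite /rho; lra.
  have rhopsi : rho < psi x by rewrite /rho; lra.
  have av : a <= v by exact: (fiber_sup_ge f tau_le ab).
  have /choice[y_ yP] k : exists y, B k y /\ rho < tau y - k%:R * mdist (h (f y)) (h x).
    apply: contrapT => ny; suff : psi_ k x <= rho.
      by apply/negP; rewrite -ltNge; exact: lt_le_trans (psi_inf x k).
    apply: lipschitz_envelope_le; first by lra.
    move=> _ [y By <-] /=; rewrite leNgt; apply/negP => rhoy.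
    by apply: ny; exists y.
  have [|y [G [GP Gy GA]]] := @totally_bounded_cluster M s y_ m M_cs.
    by move=> k i ki; apply: (BC k i) => //; have [] := yP i.
  have fyx : f y = x.
    apply: (can_inj hK); apply: mdist_positivity; apply/eqP.
    rewrite eq_le mdist_ge0 andbT; apply/ler_addgt0Pl => e e0.
    have e20 : 0 < e / 2 by rewrite divr_gt0.
    have G1 : G [set z | mdist (h (f y)) (h (f z)) < e / 2].
      have /cvg_ballP/(_ _ e20) : h \o f @ y --> h (f y).
        by apply: continuous_comp; [exact: cf|exact: ch].
      by move=> /Gy; apply: filterS => z /=; rewrite ballEmdist.
    have G2 : G [set z | mdist (h (f z)) (h x) < e / 2].
      apply: GA; near=> i.
      have [By rhoy] := yP i.
      have i0 : (0 : R) < i%:R by rewrite ltr0n; near: i; exact: nbhs_infty_gt.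
      have : i%:R * mdist (h (f (y_ i))) (h x) < b - rho by have := tau_le (y_ i); lra.
      rewrite mulrC -ltr_pdivlMr// => /lt_le_trans; apply.
      rewrite ler_pdivrMr// mulrC -ler_pdivrMr//.
      by near: i; exact: nbhs_infty_ger.
    have [z [/= z1 z2]] := filter_ex (filterI G1 G2).
    have := metric_triangle (h (f y)) (h (f z)) (h x).
    by lra.
  have : rho <= tau y.
    apply/ler_addgt0Pr => e e0.
    have G1 : G [set z | `|tau y - tau z| < e].
      have /cvgrPdist_lt/(_ _ e0)/Gy : tau @ y --> tau y by exact: ctau.
      exact: filterS.
    have G2 : G [set z | rho < tau z].
      apply: GA; apply: nearW => i; have [_ rhoy] := yP i.
      apply: lt_le_trans rhoy _.
      by rewrite lerBlDr lerDl mulr_ge0// mdist_ge0.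
    have [z [/= z1 z2]] := filter_ex (filterI G1 G2).
    by move: z1; rewrite ltr_norml => /andP[]; lra.
  have : tau y <= fiber_sup a f tau setT (f y) by exact: (fiber_sup_ub f tau_le ab).
  by rewrite fyx -/v; lra.
- have [_ Epsi] := pcp_decr pcpE psi_USAb Cpsi psi_cvg.
  apply: (cvgr_to_ge Epsi).
  apply: nearW => k; apply: ltW; apply: (lt_le_trans (BP k).2).
  apply: (pcp_le pcpE).
  + by apply: fiber_sup_USAb; have [] := BP k.
  + exact: Cb_USAb.
  + move=> x; apply: fiber_sup_le; first exact: psi_ge.
    move=> y By yx; have := psi_ub k y x By.
    by rewrite yx mdistxx mulr0 subr0.
Unshelve. all: by end_near. Qed.

End FiberSup.

End Capacitability.

(** * Approximation from below by functions with finitely many values *)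

Section Levels.
Context {R : realType} {T : topologicalType}.
Variables (phi : T -> R) (a : R) (q : nat -> R).

(** Having finitely many values is what makes suprema over fibers attained, through
    [level_graph_gap]; density of [q] makes these functions increase to [phi], so that continuity
    from below applies. *)
Fixpoint level n x : R :=
  if n is n'.+1 then
    if q n' <= phi x then Num.max (level n' x) (q n') else level n' x
  else a.

(* A subset of the hypograph of [level n] containing its graph. *)
Fixpoint level_graph n : set (T * R) :=
  if n is n'.+1 then
    level_graph n' `|` (fun x => (x, q n')) @` [set x | q n' <= phi x]
  else (fun x => (x, a)) @` setT.

Hypothesis a_le : forall x, a <= phi x.

Lemma level_ge n x : a <= level n x.
Proof. by elim: n => //= n ih; case: ifP => // _; rewrite le_max ih. Qed.

Lemma level_le n x : level n x <= phi x.
Proof. by elim: n => //= n ih; case: ifP => // qphi; rewrite ge_max ih. Qed.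

Lemma level_nondecreasing x : nondecreasing_seq (level ^~ x).
Proof.
by apply/nondecreasing_seqP => n /=; case: ifP => // _; rewrite le_max lexx.
Qed.

Lemma level_incr_to : (forall x y : R, x < y -> exists n, x < q n < y) ->
  forall x, seq_incr_to (level ^~ x) (phi x).
Proof.
move=> q_dense x; split; first exact: level_nondecreasing.
apply/cvgrPdist_lt => e e0.
have [|n /andP[qn1 qn2]] := q_dense (phi x - e) (phi x); first by lra.
near=> m; rewrite ger0_norm ?subr_ge0 ?level_le//.
have : q n <= level n.+1 x by rewrite /= (ltW qn2) le_max lexx orbT.
have : level n.+1 x <= level m x.
  by apply: level_nondecreasing; near: m; exact: nbhs_infty_ge.
by lra.
Unshelve. all: by end_near. Qed.

Lemma level_USAb n : polish R T -> USAb phi -> USAb (level n).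
Proof.
move=> Tpol [/bounded_funE[N phiN] aphi]; split.
  apply/bounded_funE; exists (Num.max `|a| N) => x; rewrite le_max.
  have h1 := level_ge n x; have h2 := level_le n x.
  have [l0|l0] := leP 0 (level n x).
    apply/orP; right; rewrite ger0_norm//; apply: le_trans (phiN x).
    exact: le_trans (ler_norm _).
  by apply/orP; left; rewrite !ltr0_norm ?lerN2//; exact: le_lt_trans l0.
move=> t; elim: n => [|n ih] /=.
  have [ta|nta] := boolP (t <= a).
    by rewrite (_ : [set _ | _] = setT); [exact/analytic_closed/closedT|exact/seteqP].
  rewrite (_ : [set _ | _] = set0); first exact: analytic_set0.
  by apply/seteqP; split => // x /=.
have [tq|nqt] := boolP (t <= q n).
  rewrite (_ : [set x | _] = [set x | t <= level n x] `|` [set x | q n <= phi x]).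
    exact: analytic_setU.
  apply/seteqP; split => x /=.
    by case: ifP => [qx _|_ tx]; [right|left].
  case: ifP => [_ _|_ []//].
  by rewrite le_max tq orbT.
rewrite (_ : [set x | _] = [set x | t <= level n x])//.
apply/seteqP; split => x /=; case: ifP => // _; rewrite le_max.
  by rewrite (negbTE nqt) orbF.
by move=> ->.
Qed.

(** A finite union of horizontal copies of superlevel sets of [phi]. The exact graph of [level n]
    would instead involve differences of analytic sets, which need not be analytic. *)
Lemma level_graph_analytic n : polish R T -> USAb phi ->
  analytic R (level_graph n).
Proof.
move=> Tpol [_ aphi]; have pair_continuous (c : R) : continuous (fun x : T => (x, c)).
  move=> x; apply: (@cvg_pair _ _ _ (nbhs x) (nbhs x) (nbhs c) _ _ _ id (fun=> c)).
    exact: cvg_id.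
  exact: cvg_cst.
elim: n => [|n ih] /=; first exact/analytic_comp/analytic_closed/closedT.
by apply: analytic_setU => //; exact: analytic_comp.
Qed.

Lemma level_graph_le n z : level_graph n z -> z.2 <= level n z.1.
Proof.
elim: n => [[x _ <-]//|n ih /= [/ih zn|[x /= qx <-] /=]].
  by case: ifP => // _; rewrite le_max zn.
by rewrite qx le_max lexx orbT.
Qed.

Lemma level_graph_level n x : level_graph n (x, level n x).
Proof.
elim: n => [|n ih] /=; first by exists x.
case: ifP => [qx|_]; last by left.
have [_|_] := leP (level n x) (q n); last by left.
by right; exists x.
Qed.

Lemma level_graph_gap n t :
  exists2 t', t' < t & forall z, level_graph n z -> z.2 < t -> z.2 <= t'.
Proof.
elim: n => [|n [t' t't t'P]] /=.
  exists (if a < t then a else t - 1); first by case: ifP => // _; lra.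
  by move=> _ [x _ <-] /= ->.
exists (if q n < t then Num.max t' (q n) else t').
  by case: ifP => // qt; rewrite gt_max t't.
move=> z [Hz|[x _ <-]] zt; last by rewrite /= in zt *; rewrite zt le_max lexx orbT.
by case: ifP => _; rewrite ?le_max t'P.
Qed.

End Levels.

(** * Comparison of convex expectations *)

Section Comparison.
Context {R : realType} {T : ptopologicalType}.
Hypothesis T_polish : polish R T.

(** Continuity from below yields [r < E (level n)] for some [n]. A parametrization of
    [level_graph n] exhibits this level function as a supremum over fibers, because the parametrized
    set contains its graph and stays below it. *)
Theorem USAb_capacitable (E : (T -> R) -> R) (phi : T -> R) (r : R) :
  PCP_convex_expectation E -> USAb phi -> r < E phi ->
  exists (psi : T -> R) (psi_ : nat -> T -> R),
  [/\ forall k, Cb (psi_ k), forall x, seq_decr_to (psi_ ^~ x) (psi x),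
      USAb psi, forall x, psi x <= phi x & r <= E psi].
Proof.
move=> pcpE aphi rE; have [/bounded_funE[b phib] _] := aphi.
have b0 : 0 <= b by exact: le_trans (phib point).
(* An enumeration of the rationals; integers that code no rational are sent to 0, which does not
   affect density. *)
pose q n : R := ratr (odflt 0%Q (unpickle n)).
have q_dense (x y : R) : x < y -> exists n, x < q n < y.
  move=> /rat_in_itvoo[z]; rewrite in_itv /= => xzy.
  by exists (pickle z); rewrite /q pickleK.
have phi_ge x : - b <= phi x by have := phib x; rewrite ler_norml => /andP[].
have phi_le x : phi x <= b by exact: le_trans (ler_norm _) (phib x).
have [_ /cvgr_gt/(_ r rE)[n _ /(_ n (leqnn n)) rEn]] :=
  pcp_incr pcpE aphi (fun n => level_USAb q phi_ge n T_polish aphi)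
    (level_incr_to phi_ge q_dense).
have /analyticP[M [F [M_cs cF rF]]] := level_graph_analytic (- b) q n T_polish aphi.
have FG y : level_graph phi (- b) q n (F y) by rewrite -rF; exists y.
have F_le y : (F y).2 <= level phi (- b) q n (F y).1 by exact: level_graph_le.
pose f y := (F y).1; pose tau y := (F y).2.
have tau_le y : tau y <= b.
  by apply: le_trans (F_le y) _; apply: le_trans (phi_le (f y)); exact: level_le.
have bb : - b <= b by lra.
have levelE : fiber_sup (- b) f tau setT = level phi (- b) q n.
  apply/funext => x; apply/eqP; rewrite eq_le; apply/andP; split.
    apply: fiber_sup_le => [|y _ <-]; first exact: level_ge.
    exact: F_le.
  have : range F (x, level phi (- b) q n x) by rewrite rF; exact: level_graph_level.
  move=> [y _ Fy]; have -> : level phi (- b) q n x = tau y by rewrite /tau Fy.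
  have -> : x = f y by rewrite /f Fy.
  exact: (fiber_sup_ub f tau_le bb).
have [y0 _ _] : range F (point, level phi (- b) q n point).
  by rewrite rF; exact: level_graph_level.
have cf : continuous f by move=> y; apply: continuous_comp; [exact: cF|exact: cvg_fst].
have ctau : continuous tau by move=> y; apply: continuous_comp; [exact: cF|exact: cvg_snd].
have tau_gap t : exists2 t', t' < t & forall y, tau y < t -> tau y <= t'.
  have [t' t't t'P] := level_graph_gap phi (- b) q n t.
  by exists t' => // y; exact: t'P.
rewrite -levelE in rEn.
have [psi [psi_ [h1 h2 h3 h4 h5]]] := fiber_sup_capacitable T_polish pcpE y0 M_cs
  cf ctau tau_le bb tau_gap rEn.
exists psi, psi_; split => // x.
by apply: le_trans (h4 x) _; rewrite levelE; exact: level_le.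
Qed.

Lemma le_USAb_of_le_Cb (E E' : (T -> R) -> R) :
  PCP_convex_expectation E -> PCP_convex_expectation E' ->
  (forall phi, Cb phi -> E phi <= E' phi) ->
  forall phi, USAb phi -> E phi <= E' phi.
Proof.
move=> pcpE pcpE' EE' phi aphi; rewrite leNgt; apply/negP => lt_E.
pose r := (E phi + E' phi) / 2.
have [|psi [psi_ [Cpsi psi_cvg apsi psi_le rpsi]]] :=
    USAb_capacitable pcpE aphi (r := r); first by rewrite /r; lra.
have psi_EE' : E psi <= E' psi.
  have [_ h1] := pcp_decr pcpE apsi Cpsi psi_cvg.
  have [_ h2] := pcp_decr pcpE' apsi Cpsi psi_cvg.
  by apply: ler_cvg_to h1 h2 _; apply: nearW => k; exact: EE'.
by have := pcp_le pcpE' apsi aphi psi_le; rewrite /r in rpsi; lra.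
Qed.

(** * Linear forms dominated by an expectation up to a constant *)

Section DominatedForm.
Variables (E l : (T -> R) -> R) (alpha : R).
Hypothesis pcpE : PCP_convex_expectation E.
Hypothesis l_lin : forall c u v,
  Cb u -> Cb v -> l (c *: u + v) = c * l u + l v.
Hypothesis l_le : forall u, Cb u -> l u <= E u + alpha.

Let E0 : E 0 = 0. Proof. exact: (pcp_cst pcpE (lexx 0)). Qed.

Let lZ c u : Cb u -> l (c *: u) = c * l u.
Proof.
move=> Cu; have := l_lin 1 Cb0 Cb0; rewrite scaler0 addr0 => l0.
by rewrite -[_ *: _]addr0 l_lin//; [lra|exact: Cb0].
Qed.

Lemma dominated_ge0 u : Cb u -> (forall x, 0 <= u x) -> 0 <= l u.
Proof.
move=> Cu u0; rewrite leNgt; apply/negP => lu.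
(* Chosen so that [l (c *: u) = |alpha| + 1], whereas [c <= 0] gives [E (c *: u) <= E 0 = 0], so
   that domination allows at most [alpha]. *)
pose c := (`|alpha| + 1) / l u.
have c0 : c <= 0.
  by rewrite /c mulr_ge0_le0 ?invr_le0 ?(ltW lu)// addr_ge0.
have := l_le (Cb_scale c Cu); rewrite lZ// /c divfK ?lt_eqF//.
have : E (c *: u) <= E 0.
  apply: (pcp_le pcpE); [exact/Cb_USAb/Cb_scale|exact/Cb_USAb/Cb0|].
  by move=> x; exact: mulr_le0_ge0.
by rewrite E0 -/c; have := ler_norm alpha; lra.
Qed.

Lemma dominated_le1 : l (cst 1) <= 1.
Proof.
rewrite leNgt; apply/negP => l1.
have C1 : Cb (cst 1 : T -> R) by exact: Cb_cst.
(* As [E] preserves the constant [c >= 0], domination gives [c * (l (cst 1) - 1) <= alpha], while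
   this product equals [|alpha| + 1]. *)
pose c := (`|alpha| + 1) / (l (cst 1) - 1).
have c0 : 0 <= c by rewrite /c divr_ge0 ?subr_ge0 ?(ltW l1)// addr_ge0.
have := l_le (Cb_scale c C1); rewrite lZ//.
have -> : c *: cst 1 = cst c :> (T -> R).
  by apply/funext => x; rewrite /= [LHS]mulr1.
rewrite (pcp_cst pcpE)//.
have : c * (l (cst 1) - 1) = `|alpha| + 1 by rewrite /c divfK// gt_eqF//; lra.
by have := ler_norm alpha; lra.
Qed.

Lemma dominated_decr (u_ : nat -> T -> R) : (forall n, Cb (u_ n)) ->
  (forall x, seq_decr_to (u_ ^~ x) 0) -> (fun n => l (u_ n)) @ \oo --> 0.
Proof.
move=> Cu u_decr.
have u_ge0 n x : 0 <= u_ n x.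
  have [mono cvg0] := u_decr x.
  by rewrite -(cvg_lim _ cvg0)//; apply: nonincreasing_cvgn_ge => //; apply/cvg_ex; exists 0.
apply/cvgrPdist_lt => e e0.
(* As soon as [E (c *: u_ n) < 1], domination gives [c * l (u_ n) < |alpha| + 1], that is
   [l (u_ n) < e]. *)
pose c := (`|alpha| + 1) / e.
have c0 : 0 < c by rewrite /c divr_gt0// ltr_wpDl.
have cE : (fun n => E (c *: u_ n)) @ \oo --> 0.
  have [_] : seq_decr_to (fun n => E (c *: u_ n)) (E 0).
    apply: (pcp_decr pcpE); [exact/Cb_USAb/Cb0|by move=> n; exact: Cb_scale|].
    move=> x; have [mono cvg0] := u_decr x; split.
      by move=> m n mn; apply: ler_wpM2l; [exact: ltW|exact: mono].
    by rewrite -[X in _ --> X](mulr0 c); apply: cvgMr.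
  by rewrite E0.
move/cvgrPdist_lt : cE => /(_ 1 ltr01); apply: filterS => n /=.
rewrite !sub0r !normrN => /ltr_normlW cEn.
rewrite ger0_norm; last by apply: dominated_ge0.
have := l_le (Cb_scale c (Cu n)); rewrite lZ// => h.
have : c * l (u_ n) < `|alpha| + 1 by have := ler_norm alpha; lra.
rewrite mulrC -ltr_pdivlMr// => /lt_le_trans; apply.
by rewrite /c invf_div mulrCA mulfV ?mulr1// gt_eqF// ltr_wpDl.
Qed.

Lemma dominated_integral : exists P : subprobability (borelType T) R,
  forall u, Cb u -> (\int[P]_x (u x)%:E = (l u)%:E)%E.
Proof.
apply: daniell_stone => //.
- exact: polish_cozero.
- exact: dominated_ge0.
- exact: dominated_le1.
- exact: dominated_decr.
Qed.

End DominatedForm.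

Lemma le_Cb_of_le_separating (D : set (T -> R)) (E E' : (T -> R) -> R) :
  D `<=` @Cb R T -> submod_closed [in D] -> separates_subprobabilities D ->
  PCP_convex_expectation E -> PCP_convex_expectation E' ->
  (forall phi, D phi -> E phi <= E' phi) ->
  forall phi, Cb phi -> E phi <= E' phi.
Proof.
move=> D_Cb D_submod D_sep pcpE pcpE' EE' phi Cphi.
have Ca (u : T -> R) : Cb u -> USAb u by exact: Cb_USAb.
have E_convex F t (u v : T -> R) : PCP_convex_expectation F -> 0 <= t <= 1 ->
    Cb u -> Cb v -> F (t *: u + (1 - t) *: v) <= t * F u + (1 - t) * F v.
  by move=> pcpF t01 Cu Cv; apply: (pcp_convex pcpF); [|exact: Ca..].
(* The increment of [E] at [phi] is convex and vanishes at 0, so the zero form on the zero subspace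
   extends below it to a subgradient. *)
have [|||||l [l_lin _ l_le]] := @hahn_banach_convex R (T -> R) (@Cb R T)
    (fun u => E (phi + u) - E phi) (@Cb_submod_closed R T) _ [set 0] (fun=> 0).
- move=> t u v t01 Cu Cv.
  have -> : phi + (t *: u + (1 - t) *: v) = t *: (phi + u) + (1 - t) *: (phi + v).
    apply/funext => x; rewrite [LHS](_ : _ = phi x + (t * u x + (1 - t) * v x))//.
    by rewrite [RHS](_ : _ = t * (phi x + u x) + (1 - t) * (phi x + v x))//; ring.
  have := E_convex _ _ _ _ pcpE t01 (Cb_add Cphi Cu) (Cb_add Cphi Cv).
  lra.
- split; first by rewrite inE.
  by move=> c u v; rewrite !inE /= => -> ->; rewrite scaler0 addr0.
- by move=> _ ->; exact: Cb0.
- by move=> c u v _ _; rewrite mulr0 addr0.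
- by move=> _ ->; rewrite addr0 subrr.
(* The value at [l] of the convex conjugate of [E] over C_b: the subgradient inequality says that
   [l - E] is maximal at [phi]. *)
pose alpha := l phi - E phi.
have l_leE u : Cb u -> l u <= E u + alpha.
  move=> Cu; have := l_le _ (Cb_sub Cu Cphi).
  rewrite /= (_ : phi + (u - phi) = u); last by rewrite addrC subrK.
  rewrite (_ : u - phi = -1 *: phi + u); last by rewrite scaleN1r addrC.
  by rewrite l_lin// /alpha; lra.
have [|||||l' [l'_lin l'D l'_le]] := @hahn_banach_convex R (T -> R) (@Cb R T)
    (fun u => E' u + alpha) (@Cb_submod_closed R T) _ D l.
- move=> t u v t01 Cu Cv; have := E_convex _ _ _ _ pcpE' t01 Cu Cv; lra.
- exact: D_submod.
- exact: D_Cb.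
- by move=> c u v /D_Cb Cu /D_Cb Cv; exact: l_lin.
- by move=> u Du; apply: le_trans (l_leE _ (D_Cb _ Du)) _; rewrite lerD2r EE'.
have [Q QE] := dominated_integral pcpE l_lin l_leE.
have [Q' Q'E] := dominated_integral pcpE' l'_lin l'_le.
have QQ' : forall A : set (borelType T), measurable A -> Q A = Q' A.
  by apply/D_sep => u Du; rewrite QE ?Q'E ?l'D//; exact: D_Cb.
have : l phi = l' phi.
  apply: EFin_inj; rewrite -QE// -Q'E//.
  by apply: eq_measure_integral => A mA _; exact: QQ'.
by have := l'_le _ Cphi; rewrite /alpha; lra.
Qed.

End Comparison.

Theorem theorem4p4 (R : realType) (Omega : ptopologicalType)
    (polishOmega : polish R Omega)
    (D : set (Omega -> R))
    (D_Cb : D `<=` @Cb R Omega)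
    (D_vspace : submod_closed [in D])
    (D_1 : D (cst 1))
    (D_sep : separates_subprobabilities D)
    (E E' : (Omega -> R) -> R)
    (pcpE : PCP_convex_expectation E)
    (pcpE' : PCP_convex_expectation E') :
  (forall phi, USAb phi -> E phi <= E' phi) <->
  (forall phi, D phi -> E phi <= E' phi).
Proof.
split=> [EE' phi /D_Cb Cphi|EE']; first exact/EE'/Cb_USAb.
exact/le_USAb_of_le_Cb/(le_Cb_of_le_separating polishOmega D_Cb).
Qed.
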